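(* Let $\pi$ be a set of primes and let $\mathfrak{F}$ be a formation such that $\mathfrak{F}=\mathtt{S}\mathfrak{F}$. Then the following statements are equivalent: (1) $\mathcal{N}_{\pi'\mathfrak{F}}^{\infty}(G)=\mathrm{Int}_{\mathfrak{N}_\pi\circ\mathfrak{F}}(G)$ holds for every $G\in\mathfrak{S}$. (2) $Z_{\pi(\mathfrak{N}\circ\mathfrak{F})}(G)=\mathrm{Int}_{\mathfrak{N}_\pi\circ\mathfrak{F}}(G)$ holds for every $G\in\mathfrak{S}$. (3) $\mathfrak{F}$ satisfies the $\pi$-boundary condition (III) in $\mathfrak{S}$.
   Context: All groups are finite; classes of groups are non-empty and closed under isomorphism. $\mathbb{P}$ is the set of all primes and $\pi'=\mathbb{P}\setminus\pi$. Classes: $\mathfrak{S}$ solvable groups; $\mathfrak{N}$ nilpotent groups; $\mathfrak{G}_p$ $p$-groups; $\mathfrak{N}_\pi$ $\pi$-nilpotent groups (groups $G$ with $G/O_{\pi'}(G)$ nilpotent). A formation is a class closed under homomorphic images and subdirect products. $G^{\mathfrak{F}}$ is the smallest normal subgroup $N$ of $G$ with $G/N\in\mathfrak{F}$. For a class $\mathfrak{X}$ and a formation $\mathfrak{F}$, $\mathfrak{X}\circ\mathfrak{F}=\{G: G^{\mathfrak{F}}\in\mathfrak{X}\}$. $\mathfrak{F}=\mathtt{S}\mathfrak{F}$ means $\mathfrak{F}$ is closed under subgroups. The $\pi'\mathfrak{F}$-norm of $G$ is $\mathcal{N}_{\pi'\mathfrak{F}}(G)=\bigcap_{H\leq G}N_G(H^{\mathfrak{F}}O_{\pi'}(G))$.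 Put $\mathcal{N}^0_{\pi'\mathfrak{F}}(G)=1$ and $\mathcal{N}^{i}_{\pi'\mathfrak{F}}(G)/\mathcal{N}^{i-1}_{\pi'\mathfrak{F}}(G)=\mathcal{N}_{\pi'\mathfrak{F}}(G/\mathcal{N}^{i-1}_{\pi'\mathfrak{F}}(G))$ for $i\ge1$; $\mathcal{N}^{\infty}_{\pi'\mathfrak{F}}(G)$ is the terminal term of this ascending series. For a formation $\mathfrak{M}$, a chief factor $L/K$ of $G$ is $\mathfrak{M}$-central in $G$ if $(L/K)\rtimes(G/C_G(L/K))\in\mathfrak{M}$. A normal subgroup $N$ of $G$ is $\pi\mathfrak{M}$-hypercentral in $G$ if $N=1$, or $N>1$ and every chief factor of $G$ below $N$ of order divisible by at least one prime in $\pi$ is $\mathfrak{M}$-central in $G$. $Z_{\pi\mathfrak{M}}(G)$ is the product of all $\pi\mathfrak{M}$-hypercentral normal subgroups of $G$; $Z_{\pi(\mathfrak{N}\circ\mathfrak{F})}(G)$ is this subgroup for $\mathfrak{M}=\mathfrak{N}\circ\mathfrak{F}$. A subgroup $U$ of $G$ is $\mathfrak{X}$-maximal in $G$ if $U\in\mathfrak{X}$ and there is no subgroup $V$ of $G$ with $U<V$ and $V\in\mathfrak{X}$; $\mathrm{Int}_{\mathfrak{X}}(G)$ is the intersection of all $\mathfrak{X}$-maximal subgroups of $G$. $\mathrm{Crit}_{\mathtt{S}}(\mathfrak{X})$ is the class of groups $G\notin\mathfrak{X}$ all of whose proper subgroups belong to $\mathfrak{X}$. $\mathfrak{F}$ satisfies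 the $\pi$-boundary condition (III) in $\mathfrak{S}$ if $\mathrm{Crit}_{\mathtt{S}}(\mathfrak{G}_p\circ\mathfrak{F})\cap\mathfrak{S}\subseteq\mathfrak{N}_\pi\circ\mathfrak{F}$ for every $p\in\pi$. *)

(* Defs.v *)
From mathcomp Require Import all_boot all_fingroup all_solvable.
From mathcomp Require Import boolp.

Set Implicit Arguments.
Unset Strict Implicit.
Unset Printing Implicit Defensive.

Import GroupScope.

Definition group_class := forall gT : finGroupType, {group gT} -> Prop.

Definition nonempty (X : group_class) : Prop :=
  exists (gT : finGroupType) (G : {group gT}), X gT G.

Definition isog_closed (X : group_class) : Prop :=
  forall (gT rT : finGroupType) (G : {group gT}) (H : {group rT}),
  G \isog H -> X gT G -> X rT H.

Definition image_closed (X : group_class) : Prop :=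
  forall (gT rT : finGroupType) (G : {group gT}) (f : {morphism G >-> rT}),
  X gT G -> X rT (f @* G)%G.

(* Two factors suffice: finite subdirect products follow by induction. *)
Definition subdirect_closed (X : group_class) : Prop :=
  forall (gT1 gT2 : finGroupType) (G1 : {group gT1}) (G2 : {group gT2})
    (D : {group gT1 * gT2}),
  [set x.1 | x in D] = G1 -> [set x.2 | x in D] = G2 ->
  X gT1 G1 -> X gT2 G2 -> X (gT1 * gT2)%type D.

Definition subgroup_closed (X : group_class) : Prop :=
  forall (gT : finGroupType) (G H : {group gT}),
  H \subset G -> X gT G -> X gT H.

Definition formation (F : group_class) : Prop :=
  [/\ nonempty F, isog_closed F, image_closed F & subdirect_closed F].

Definition p_groups (p : nat) : group_class := fun gT G => p.-group G.

Definition nilpotent_groups : group_class := fun gT G => nilpotent G.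

Definition pi_nilpotent_groups (pi : nat_pred) : group_class :=
  fun gT G => nilpotent (G / 'O_pi^'(G)).

(* For a formation F this is the smallest N <| G with G / N in F; see
   residualP. *)
Definition residual (F : group_class) (gT : finGroupType) (G : {group gT}) :
    {set gT} :=
  \bigcap_(N : {group gT} | (N <| G) && `[< F _ (G / N)%G >]) N.

Canonical residual_group (F : group_class) (gT : finGroupType)
  (G : {group gT}) := Eval hnf in [group of residual F G].

Lemma formation_quotientI (F : group_class) (gT : finGroupType)
    (G M N : {group gT}) :
  formation F -> M <| G -> N <| G -> F _ (G / M)%G -> F _ (G / N)%G ->
  F _ (G / (M :&: N))%G.
Proof.
move=> [_ isoF _ subF] nsMG nsNG FM FN.
have [nMG nNG] := (normal_norm nsMG, normal_norm nsNG).
pose f x := (coset M x, coset N x).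
have fM : {in G &, {morph f : x y / x * y}}.
  move=> x y Gx Gy; rewrite /f !morphM ?(subsetP nMG) ?(subsetP nNG) //.
pose fm := Morphism fM.
have kerf : 'ker fm = M :&: N.
  apply/setP=> x; apply/idP/idP.
    case/morphpreP=> Gx /set1P[Mx Nx]; apply/setIP; split.
      exact: coset_idr (subsetP nMG x Gx) Mx.
    exact: coset_idr (subsetP nNG x Gx) Nx.
  case/setIP=> Mx Nx; apply/morphpreP; split.
    exact: subsetP (normal_sub nsMG) x Mx.
  by apply/set1P; rewrite /= /f (coset_id Mx) (coset_id Nx).
have FD : F _ (fm @* G)%G.
  apply: subF FM FN; rewrite /= morphimEdom -imset_comp quotientE
    morphimEsub //; apply: eq_imset => x //.
have := first_isog fm; rewrite kerf isog_sym => iso.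
by apply: isoF FD.
Qed.

Lemma residualP (F : group_class) (gT : finGroupType) (G : {group gT}) :
  formation F ->
  [/\ residual F G <| G, F _ (G / residual F G)%G
    & forall N : {group gT}, N <| G -> F _ (G / N)%G -> residual F G \subset N].
Proof.
move=> formF; have [[aT [A FA]] isoF imF _] := formF.
pose P (N : {group gT}) := (N <| G) && `[< F _ (G / N)%G >].
have PG : P G.
  rewrite /P normal_refl; apply/asboolP.
  have := imF _ _ _ (trivm A : {morphism A >-> coset_of G}) FA.
  apply: isoF; rewrite /= morphim_trivm trivg_quotient.
  exact: isog_refl.
case: (arg_minnP (fun N : {group gT} => #|N|) PG) => N PN minN.
have [nsNG /asboolP FN] := andP PN.
have NP (M : {group gT}) : M <| G -> F _ (G / M)%G -> N \subset M.
  move=> nsMG FM; have PNM : P (N :&: M)%G.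
    rewrite /P normalI //; apply/asboolP; exact: formation_quotientI.
  have /eqP <- : (N :&: M)%G :==: N by rewrite eqEcard subsetIl minN.
  exact: subsetIr.
have resE : residual_group F G = N.
  apply/group_inj/eqP; rewrite eqEsubset /= bigcap_inf //=.
  by apply/bigcapsP=> M /andP[nsMG /asboolP]; exact: NP.
by rewrite -resE in nsNG FN NP.
Qed.

(* The class X o F. *)
Definition residual_product (X F : group_class) : group_class :=
  fun gT G => X gT (residual_group F G).

Section Norm.

Variables (pi : nat_pred) (F : group_class).

Definition norm_subgroup (gT : finGroupType) (G : {group gT}) : {set gT} :=
  \bigcap_(H : {group gT} | H \subset G) 'N_G(residual F H * 'O_pi^'(G)).

Canonical norm_subgroup_group (gT : finGroupType) (G : {group gT}) :=
  Eval hnf in [group of norm_subgroup G].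

Fixpoint norm_series (gT : finGroupType) (G : {group gT}) (n : nat) :
    {group gT} :=
  if n is m.+1 then
    let K := norm_series G m in (coset K @*^-1 norm_subgroup (G / K))%G
  else 1%G.

(* The ascending series is stationary from index #|G| on, see
   norm_series_stable. *)
Definition hyper_norm (gT : finGroupType) (G : {group gT}) : {group gT} :=
  norm_series G #|G|.

Lemma norm_series_sub (gT : finGroupType) (G : {group gT}) n :
  norm_series G n \subset G.
Proof.
elim: n => [|n IHn]; first exact: sub1G.
set K := norm_series G n in IHn *.
have sNG : norm_subgroup (G / K)%G \subset G / K.
  exact: subset_trans (bigcap_inf (G / K)%G (subxx _)) (subsetIl _ _).
have nsK : K <| 'N_G(K) by rewrite /normal subsetI IHn normG subsetIr.
rewrite /= -/K (subset_trans (morphpreS _ sNG)) // -quotientInorm.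
by rewrite quotientGK ?subsetIl.
Qed.

Lemma norm_series_stable (gT : finGroupType) (G : {group gT}) n :
  #|G| <= n -> norm_series G n = hyper_norm G.
Proof.
pose step (K : {group gT}) := (coset K @*^-1 norm_subgroup (G / K))%G.
have ascend m : norm_series G m \subset norm_series G m.+1.
  by rewrite /= -{1}(ker_coset (norm_series G m)) morphpreS ?sub1G.
have stable m k : norm_series G m = norm_series G m.+1 ->
    norm_series G (k + m) = norm_series G m.
  move=> eqm; elim: k => // k IHk.
  by rewrite addSn [RHS]eqm; exact: (congr1 step IHk).
have grow m : norm_series G m = norm_series G m.+1 \/
    m < #|norm_series G m|.
  elim: m => [|m [eqm|ltm]]; first by right; apply: cardG_gt0.
    by left; exact: (congr1 step eqm).
  have [eqm|neqm] := eqVneq (norm_series G m) (norm_series G m.+1).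
    by left; exact: (congr1 step eqm).
  right; apply: leq_ltn_trans ltm _; apply: proper_card.
  by rewrite properEneq ascend andbT; apply: contraNneq neqm => /group_inj->.
have [eqG|] := grow #|G|.
  by move=> leGn; rewrite -(subnK leGn) stable.
by rewrite ltnNge subset_leq_card ?norm_series_sub.
Qed.

End Norm.

Section Central.

Variables (gT : finGroupType) (G : {group gT}).

Lemma chief_acts (K L : {group gT}) : chief_factor G K L ->
  {acts G / 'C_G(L / K | 'Q), on group L / K | 'Q %% 'C_G(L / K | 'Q)}.
Proof.
case/andP=> /maxgroupp/andP[/proper_sub sKL nKG] /andP[sLG nLG].
have sCC: 'C_G(L / K | 'Q) \subset 'C(L / K | 'Q) by exact: subsetIr.
split; last first.
  have sC: 'C_G(L / K | 'Q) \subset qact_dom 'J K.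
    by apply/subsetP=> x /(subsetP sCC); exact: astab_dom.
  by rewrite gacentC ?sC ?sCC ?quotientS ?subsetT.
by rewrite astabs_mod // quotientS // (actsQ nKG nLG).
Qed.

(* [set: sdprod_by <[chief_acts LK]>%gact] is the external semidirect product of
   L / K by G / C_G(L / K), acting by conjugation. *)
Definition central_factor (M : group_class) (K L : {group gT})
    (LK : chief_factor G K L) : Prop :=
  M _ [set: sdprod_by <[chief_acts LK]>%gact]%G.

Definition hypercentral (pi : nat_pred) (M : group_class) (N : {group gT}) :
    Prop :=
  N <| G /\
  (N :=: 1 \/
   forall (K L : {group gT}) (LK : chief_factor G K L),
     L \subset N -> (exists2 p, p \in pi & p %| #|L / K|) ->
     central_factor M LK).

(* A product of normal subgroups of G, hence the subgroup they generate. *)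
Definition hypercenter (pi : nat_pred) (M : group_class) : {group gT} :=
  (\prod_(N : {group gT} | `[< hypercentral pi M N >]) N)%G.

Definition class_maximal (X : group_class) (U : {group gT}) : Prop :=
  [/\ U \subset G, X gT U
    & ~ exists V : {group gT}, [/\ V \subset G, U \proper V & X gT V]].

Definition Int (X : group_class) : {set gT} :=
  \bigcap_(U : {group gT} | `[< class_maximal X U >]) U.

End Central.

Definition Crit (X : group_class) : group_class :=
  fun gT G => ~ X gT G /\ forall H : {group gT}, H \proper G -> X gT H.

Definition boundary_condition_III (pi : nat_pred) (F : group_class) : Prop :=
  forall p, p \in pi -> forall (gT : finGroupType) (G : {group gT}),
  Crit (residual_product (p_groups p) F) G -> solvable G ->
  residual_product (pi_nilpotent_groups pi) F G.

(* Main.v *)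
(* For solvable G a chief factor L / K is N o F-central if and only if the
   residual R = G^F centralises it: R is normal, so in the semidirect product
   L / K : G / C the nilpotent residual commutes with the minimal normal
   subgroup L / K.  Hence Z_{pi(N o F)}(G) is the largest N having a G-series
   whose factors are pi'-groups or centralised by R.  The hyper-norm is the same
   subgroup for every solvable G, so (1) and (2) only differ in notation: if a
   normal p-subgroup P normalises all residuals H^F, then G^F / C(P) is a
   p-group, by a Frattini argument.
   Given (2), for a critical G outside N_pi o F the regular wreath product of
   C_p by G has its base in Int = Z, which forces G^F to be a p-group.
   Given (3), if L is a p-chief factor below Int and (G / C(L))^F is not a
   p-group, then G / C(L) contains a critical subgroup B; a minimal supplement V
   lifting B lies in N_pi o F, so does V L, and then B^F is a p-group. *)
Require Import Defs.
From mathcomp Require Import all_boot all_fingroup all_solvable.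
From mathcomp Require Import boolp ssralg finalg zmodp matrix.
From mathcomp Require Import mxrepresentation mxabelem.

Set Implicit Arguments.
Unset Strict Implicit.
Unset Printing Implicit Defensive.

Import GroupScope.

(** * Residuals *)

Section Residual.

Variables (F : group_class) (formF : formation F) (subF : subgroup_closed F).

Lemma formation_homg (aT rT : finGroupType) (G : {group aT}) (H : {group rT}) :
  H \homg G -> F G -> F H.
Proof.
have [_ isoF imF _] := formF.
case/homgP=> f fG /(imF _ _ _ f); apply: isoF.
by rewrite /= fG isog_refl.
Qed.

Lemma residual_normal (gT : finGroupType) (G : {group gT}) : residual F G <| G.
Proof. by case: (residualP G formF). Qed.

Lemma residual_sub (gT : finGroupType) (G : {group gT}) :
  residual F G \subset G.
Proof. exact: normal_sub (residual_normal G). Qed.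

Lemma residual_min (gT : finGroupType) (G N : {group gT}) :
  N <| G -> F (G / N)%G -> residual F G \subset N.
Proof. by case: (residualP G formF) => _ _; apply. Qed.

Lemma residual_quotient_mem (gT : finGroupType) (G : {group gT}) :
  F (G / residual_group F G)%G.
Proof. by case: (residualP G formF). Qed.

(** Minimality of a residual gives each inclusion: [f @* G] modulo the image of [residual F G] is an
    image of [G / residual F G], and [G] modulo the preimage of the other residual is isomorphic to
    a member of [F]. *)
Lemma residual_morphim_dom (aT rT : finGroupType) (G : {group aT})
    (f : {morphism G >-> rT}) : residual F (f @* G) = f @* residual F G.
Proof.
apply/eqP; rewrite eqEsubset; apply/andP; split.
  apply: (@residual_min _ _ (f @* residual_group F G)%G).
    exact: morphim_normal (residual_normal G).
  apply: formation_homg (residual_quotient_mem G); apply/homgP.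
  exists (quotm_morphism f (residual_normal G)) => //=.
  exact: morphim_quotm.
have nsSfG := residual_normal (f @* G)%G.
rewrite sub_morphim_pre ?residual_sub //.
set S := residual_group F (f @* G)%G.
have sGD : G \subset f @*^-1 'N(S).
  by rewrite -sub_morphim_pre // normal_norm.
apply: (@residual_min _ _ (f @*^-1 S)%G).
  have := nsSfG; rewrite -(morphpre_normal (normal_sub nsSfG)) //.
  by rewrite morphimGK ?(normal_sub (ker_normal f)).
apply: formation_homg (residual_quotient_mem (f @* G)%G).
have := first_isog_loc [morphism of coset S \o f] sGD.
rewrite ker_comp ker_coset /= morphim_comp => /isog_hom.
by rewrite (setIidPr (subsetIl _ _)).
Qed.

Lemma residual_morphim (aT rT : finGroupType) (D G : {group aT})
    (f : {morphism D >-> rT}) :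
  G \subset D -> residual F (f @* G) = f @* residual F G.
Proof.
move=> sGD; have := residual_morphim_dom (restrm_morphism sGD f).
rewrite morphim_restrm (setIidPr (residual_sub G)) => <-.
by congr (residual F _); apply: val_inj; rewrite /= morphim_restrm setIid.
Qed.

Lemma residual_quotient (gT : finGroupType) (G K : {group gT}) :
  G \subset 'N(K) -> residual F (G / K) = residual F G / K.
Proof. exact: residual_morphim. Qed.

(** Modulo [residual F G] the image of [H] is a subgroup of a member of [F], so its residual is
    trivial. *)
Lemma residualS (gT : finGroupType) (H G : {group gT}) :
  H \subset G -> residual F H \subset residual F G.
Proof.
move=> sHG; have nRG := normal_norm (residual_normal G).
have nRH := subset_trans sHG nRG.
rewrite -quotient_sub1 ?(subset_trans (residual_sub H)) //.
rewrite -residual_quotient //.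
apply: (@residual_min _ _ 1%G); first exact: normal1.
apply: (formation_homg (G := (H / residual_group F G)%G)).
  by rewrite quotient_homg ?norms1.
by apply: subF (residual_quotient_mem G); apply: quotientS.
Qed.

Lemma residualJ (gT : finGroupType) (H : {group gT}) x :
  residual F (H :^ x) = residual F H :^ x.
Proof.
have := residual_morphim (conjgm_morphism [set: gT]%G x) (subsetT H).
rewrite morphim_conj setTI => <-; congr (residual F _); apply: val_inj.
by rewrite /= morphim_conj setTI.
Qed.

End Residual.

(** * Series with factors that are centralised or of coprime order *)

(** Arbitrary normal factors are allowed instead of chief factors, and the centralising group [R] is
    a parameter, so that series pass to subgroups and images. With [R] the residual of [G] this
    describes the hypercenter; with [R] and [N] both equal to a solvable [G] it describes
    pi-nilpotency. *)
Inductive pi_hypercentral (pi : nat_pred) (gT : finGroupType)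
    (G R : {group gT}) : {group gT} -> Prop :=
| pi_hypercentral1 : pi_hypercentral pi G R 1%G
| pi_hypercentralS (M N : {group gT}) :
    pi_hypercentral pi G R M -> M \subset N -> N <| G ->
    pi^'.-nat #|N : M| \/ [~: N, R] \subset M -> pi_hypercentral pi G R N.

Section PiHypercentral.

Variable pi : nat_pred.

(** Here [M] need not lie in [A]: [#|A : M|] is then the index of [A :&: M] in [A], which equals the
    index of [M] in [A * M]. *)
Lemma index_norm_dvd (gT : finGroupType) (A M N : {group gT}) :
  A \subset N -> M <| N -> #|A : M| %| #|N : M|.
Proof.
move=> sAN /andP[sMN nMN]; have nMA := subset_trans sAN nMN.
by rewrite -indexMg -norm_joinEr // indexSg ?joing_subl // join_subG sMN.
Qed.

Lemma index_join_dvd (gT : finGroupType) (A M N : {group gT}) :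
  N \subset 'N(A) -> M \subset N -> #|A <*> N : A <*> M| %| #|N : M|.
Proof.
move=> nAN sMN; have nAM := subset_trans sMN nAN.
have -> : A <*> N = (A <*> M) * N.
  by rewrite !norm_joinEr // -mulgA (mulSGid sMN).
by rewrite indexMg indexgS ?joing_subr.
Qed.

Section Fixed.
Variables (gT : finGroupType) (G R : {group gT}).

Lemma pi_hypercentral_normal (N : {group gT}) :
  pi_hypercentral pi G R N -> N <| G.
Proof. by case=> [|M L _ _ //]; apply: normal1. Qed.

(** The series of [N] is intersected with [C]. Indices can only shrink to divisors, and a commutator
    with [B] stays in [C] because [B], lying in [A], normalises [C]. *)
Lemma pi_hypercentral_sub (A B C N : {group gT}) :
    pi_hypercentral pi G R N -> A \subset G -> B \subset R -> B \subset A ->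
  C <| A -> C \subset N -> pi_hypercentral pi A B C.
Proof.
move=> hypN sAG sBR sBA nsCA sCN.
have -> : C = (N :&: C)%G by apply/val_inj; rewrite /= (setIidPr sCN).
elim: hypN {sCN} => [|{}M {}N hypM IHM sMN nsNG step].
  rewrite (_ : _ :&: _ = 1)%G; first exact: pi_hypercentral1.
  exact/val_inj/setIidPl/sub1G.
have nsI (K : {group gT}) : K <| G -> (K :&: C)%G <| A.
  move=> nsKG; apply/andP; split.
    exact: subset_trans (subsetIr _ _) (normal_sub nsCA).
  by rewrite normsI ?(normal_norm nsCA) // (subset_trans sAG) ?normal_norm.
apply: (pi_hypercentralS IHM); [exact: setSI | exact: nsI |].
case: step => [pi'MN | sNRM]; [left | right].
  apply: pnat_dvd pi'MN.
  have nsMN : M <| N.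
    by apply: normalS sMN (normal_sub nsNG) (pi_hypercentral_normal hypM).
  have /= := index_norm_dvd (subsetIl N C) nsMN.
  rewrite -[#|N :&: C : M|]indexgI; congr (#|_ : _| %| _).
  by rewrite setIAC (setIidPr sMN).
rewrite subsetI (subset_trans _ sNRM) ?commgSS ?subsetIl //=.
rewrite (subset_trans (commgSS (subsetIr N C) (subxx B))) //.
by rewrite commg_subl (subset_trans sBA) ?normal_norm.
Qed.

Lemma pi_hypercentralY (M N : {group gT}) : R \subset G ->
  pi_hypercentral pi G R M -> pi_hypercentral pi G R N ->
  pi_hypercentral pi G R (M <*> N)%G.
Proof.
move=> sRG hypM hypN; have nsMG := pi_hypercentral_normal hypM.
elim: hypN => [|{}K {}N hypK IHK sKN nsNG step].
  rewrite (_ : _ <*> _ = M)%G //.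
  by apply/val_inj/joing_idPl/sub1G.
apply: (pi_hypercentralS IHK); [exact: genS (setUS _ sKN)|exact: normalY|].
have nMN: N \subset 'N(M).
  by rewrite (subset_trans (normal_sub nsNG)) ?normal_norm.
case: step => [pi'KN | sNRK]; [left | right].
  by apply: pnat_dvd pi'KN; apply: index_join_dvd.
have nsMK : M <*> K <| G by rewrite normalY ?(pi_hypercentral_normal hypK).
have nMK (L : {group gT}) : L \subset G -> L \subset 'N(M <*> K).
  by move=> sLG; rewrite (subset_trans sLG) ?(normal_norm nsMK).
have [sMG sNG] := (normal_sub nsMG, normal_sub nsNG).
rewrite -quotient_cents2 ?nMK ?join_subG ?sMG //=.
rewrite quotientY ?nMK // quotientS1 ?joing_subl // join_subG sub1G /=.
by rewrite quotient_cents2 ?nMK // (subset_trans sNRK) ?joing_subr.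
Qed.

(** A factor of the p-group [V] that is a pi'-group is trivial, since [p] is in [pi]; any other
    factor is centralised by [Q]. By coprime action a p'-group that centralises every factor of a
    p-group centralises the whole of it. *)
Lemma pi_hypercentral_p'subgroup (V Q : {group gT}) (p : nat) :
    pi_hypercentral pi G R V -> p.-group V -> p \in pi -> Q \subset R ->
  R \subset G -> p^'.-group Q -> Q \subset 'C(V).
Proof.
move=> hypV pV pi_p sQR sRG p'Q; have sQG := subset_trans sQR sRG.
elim: hypV pV => [|M N hypM IHM sMN nsNG step] pN; first exact: cents1.
have pM := pgroupS sMN pN; have cMQ := IHM pM.
have nsMG := pi_hypercentral_normal hypM.
have [nMG nNG] := (normal_norm nsMG, normal_norm nsNG).
have nMN := subset_trans (normal_sub nsNG) nMG.
case: step => [pi'NM | sNRM].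
  have -> //: N :=: M.
  apply/eqP; rewrite eqEsubset sMN andbT -indexg_eq1.
  apply/eqP/(@pnat_1 p); first exact: pnat_dvd (dvdn_indexg _ _) pN.
  by apply: sub_in_pnat pi'NM => q _; apply: contraNneq => ->.
have coMQ : coprime #|M| #|Q| by apply: pnat_coprime pM p'Q.
have := coprime_norm_quotient_cent (subset_trans sQG nNG)
  (subset_trans sQG nMG) coMQ (pgroup_sol pM).
have /setIidPl -> : N / M \subset 'C(Q / M).
  rewrite quotient_cents2 ?(subset_trans sQG) //.
  by apply: subset_trans sNRM; apply: commgS.
move/quotient_inj=> defN; rewrite centsC.
apply/setIidPl/defN; rewrite /normal ?sMN //.
by rewrite subsetI sMN centsC cMQ (subset_trans (subsetIl _ _)).
Qed.

(** A Jordan-Hoelder argument. Where the series first satisfies [L \subset N <*> K], the previous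
    term [M] has [L :&: (M <*> K) = K], because [L / K] is chief. Hence the step from [M] to [N]
    controls [L / K], and the divisor [p] rules out the coprime case. *)
Lemma pi_hypercentral_chief (N K L : {group gT}) (p : nat) :
    pi_hypercentral pi G R N -> R \subset G -> chief_factor G K L ->
    p \in pi -> prime p -> p %| #|L / K| -> L \subset N <*> K ->
  [~: L, R] \subset K.
Proof.
move=> hypN sRG chiefL pi_p pr_p p_dv_LK.
have [/maxgroupP[/andP[/andP[sKL ltKL] nKG] maxK] nsLG] := andP chiefL.
have nsKG : K <| G by rewrite /normal nKG (subset_trans sKL) ?normal_sub.
elim: hypN => [|{}M {}N hypM IHM sMN nsNG step] sLNK.
  by case/negP: ltKL; rewrite joing1G in sLNK.
have [sLMK | nsLMK] := boolP (L \subset M <*> K); first exact: IHM.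
have nsMG := pi_hypercentral_normal hypM.
have nsMKG : M <*> K <| G by rewrite normalY.
have defK : L :&: (M <*> K) = K.
  apply: (maxK (L :&: (M <*> K))%G); last by rewrite subsetI sKL joing_subr.
  rewrite normsI ?normal_norm // andbT /proper subsetIl.
  by apply: contra nsLMK => /subset_trans-> //; apply: subsetIr.
have nMK (A : {group gT}) : A \subset G -> A \subset 'N(M <*> K).
  by move=> sAG; rewrite (subset_trans sAG) ?(normal_norm nsMKG).
have [sNG sLG] := (normal_sub nsNG, normal_sub nsLG).
case: step => [pi'NM | sNRM].
  have : pi^'.-nat #|L / K|.
    rewrite card_quotient ?(subset_trans sLG) // -defK indexgI.
    apply: pnat_dvd pi'NM.
    have := index_join_dvd (subset_trans sNG (normal_norm nsKG)) sMN.
    apply: dvdn_trans; rewrite !(joingC K) index_norm_dvd //.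
    apply: normalS nsMKG; first by rewrite genS ?setSU.
    by rewrite join_subG sNG normal_sub.
  move/pnatP=> /(_ (cardG_gt0 _) p pr_p p_dv_LK).
  by rewrite inE /= pi_p.
suff: [~: L, R] \subset L :&: (M <*> K) by rewrite defK.
rewrite subsetI commg_subl (subset_trans sRG) ?(normal_norm nsLG) //=.
rewrite -quotient_cents2 ?nMK //.
apply: subset_trans (quotientS _ sLNK) _.
rewrite quotientY ?nMK ?(normal_sub nsKG) // (quotientS1 (joing_subr M K)).
rewrite joingG1 quotient_cents2 ?nMK // (subset_trans sNRM) //.
exact: joing_subl.
Qed.

End Fixed.

Lemma pi_hypercentral_morphim (aT rT : finGroupType) (D G R N : {group aT})
    (f : {morphism D >-> rT}) :
    G \subset D -> R \subset G -> pi_hypercentral pi G R N ->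
  pi_hypercentral pi (f @* G)%G (f @* R)%G (f @* N)%G.
Proof.
move=> sGD sRG; elim=> [|{}M {}N hypM IHM sMN nsNG step].
  rewrite (_ : (f @* 1)%G = 1%G); first exact: pi_hypercentral1.
  by apply/val_inj; rewrite /= morphim1.
have sND := subset_trans (normal_sub nsNG) sGD.
apply: (pi_hypercentralS IHM); [exact: morphimS | exact: morphim_normal |].
case: step => [pi'NM | sNRM]; [left | right].
  apply: pnat_dvd pi'NM; apply: index_morphim.
  by rewrite (subset_trans (subsetIl _ _)).
by rewrite -morphimR ?morphimS // (subset_trans sRG).
Qed.

Lemma pi_hypercentral_comap (aT rT : finGroupType) (G R : {group aT})
    (f : {morphism G >-> rT}) (N : {group rT}) :
    R \subset G -> pi_hypercentral pi G R ('ker f)%G ->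
    pi_hypercentral pi (f @* G)%G (f @* R)%G N ->
  pi_hypercentral pi G R (f @*^-1 N)%G.
Proof.
move=> sRG hypK; elim=> [|{}M {}N hypM IHM sMN nsNG step] //.
have sNG := normal_sub nsNG.
apply: (pi_hypercentralS IHM); first exact: morphpreS.
  have := nsNG; rewrite -(morphpre_normal sNG) // morphimGK //.
  exact: normal_sub (ker_normal f).
case: step => [pi'NM | sNRM]; [left | right].
  by rewrite /= index_morphpre.
rewrite -sub_morphim_pre ?morphimR ?subsetIl //=.
  by apply: subset_trans sNRM; rewrite commSg // morphpreK.
by rewrite comm_subG ?subsetIl.
Qed.

Lemma pi_hypercentral_ext (gT : finGroupType) (G R M N : {group gT}) :
    R \subset G -> N <| G -> pi_hypercentral pi G R M ->
    pi_hypercentral pi (G / M)%G (R / M)%G (N / M)%G ->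
  pi_hypercentral pi G R N.
Proof.
move=> sRG nsNG hypM hypNM; have nsMG := pi_hypercentral_normal hypM.
have nMG := normal_norm nsMG.
(* Restricting the coset map to [G] keeps preimages inside [G], where the lifted series has to
   live. *)
pose f := restrm_morphism nMG (coset_morphism M).
have kerf : 'ker f = M.
  by rewrite ker_restrm ker_coset; apply/setIidPr/normal_sub.
have imf (A : {group gT}) : A \subset G -> (f @* A = A / M)%G.
  by move=> sAG; apply/val_inj; rewrite /= morphim_restrm (setIidPr sAG).
have := @pi_hypercentral_comap _ _ G R f (N / M)%G sRG.
rewrite !imf // (_ : 'ker f = M)%G; last exact/val_inj.
move/(_ hypM hypNM)/pi_hypercentral_sub; apply=> //.
have sNG := normal_sub nsNG.
by rewrite /= -sub_morphim_pre // morphim_restrm (setIidPr sNG).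
Qed.

End PiHypercentral.

(** * Pi-nilpotent groups *)

Section PiNilpotent.

Variable pi : nat_pred.

(** This allows work with one prime at a time. Forwards, the preimage of ['O_p^'(T / K)] is a
    p'-group because [K] is a pi'-group. Backwards, a late term of the lower central series lies in
    every ['O_p^'(T)] with [p] in [pi], so it is a pi'-group. *)
Lemma pi_nilpotentP (gT : finGroupType) (T : {group gT}) :
  pi_nilpotent_groups pi T <->
  (forall p, prime p -> p \in pi -> p.-group (T / 'O_p^'(T))).
Proof.
split=> [nilT p pr_p pi_p | pnilT].
  set K := 'O_pi^'(T)%G in nilT; have nsKT : K <| T by apply: pcore_normal.
  have hallO := nilpotent_pcore_Hall p^' nilT.
  set W := (coset K @*^-1 'O_p^'(T / K))%G.
  have iTW : #|T : W| = #|T / K : 'O_p^'(T / K)|.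
    rewrite -(index_morphpre (f := coset_morphism K)) /= ?quotientGK //.
    by rewrite sub_im_coset.
  have sWO : W \subset 'O_p^'(T).
    apply: pcore_max.
      rewrite /pgroup card_morphpre ?sub_im_coset // ker_coset pnatM.
      rewrite -!/(pgroup _ _) pcore_pgroup andbT.
      apply: sub_pgroup (pcore_pgroup _ _) => q.
      by apply: contraNneq => ->.
    by rewrite -(quotientGK nsKT) cosetpre_normal pcore_normal.
  rewrite /pgroup card_quotient ?(normal_norm (pcore_normal _ _)) //.
  apply: pnat_dvd (indexgS T sWO) _; rewrite iTW.
  by have /and3P[_ _] := hallO; rewrite (eq_pnat _ (negnK _)).
(* The lower central series is numbered from 1, and a nilpotent group has class below its order, so
   this term vanishes in every nilpotent quotient of [T]. *)
pose L := 'L_#|T|.+1(T).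
have sLO p : prime p -> p \in pi -> L \subset 'O_p^'(T).
  move=> pr_p pi_p; have pTO := pnilT p pr_p pi_p.
  have nOT := normal_norm (pcore_normal p^' T).
  rewrite -quotient_sub1 ?(subset_trans (lcn_sub _ _)) //.
  rewrite /L quotientE morphim_lcn //.
  rewrite (elimT (lcn_nil_classP _ (pgroup_nil pTO))) //.
  have := pgroup_nil pTO; rewrite nilpotent_class => /ltnW/leq_trans; apply.
  exact: leq_quotient.
have pi'L : pi^'.-group L.
  apply/pgroupP=> q pr_q q_dv_L; apply/negP=> pi_q.
  have := pgroupS (sLO q pr_q pi_q) (pcore_pgroup _ _).
  by move/pgroupP/(_ q pr_q q_dv_L); rewrite !inE eqxx.
rewrite /pi_nilpotent_groups.
have sLO' : L \subset 'O_pi^'(T) by rewrite pcore_max // lcn_normal.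
apply/lcnP; exists #|T|.
by rewrite -morphim_lcn ?(normal_norm (pcore_normal _ _)) //; apply: quotientS1.
Qed.

(** Induction along the series. A Hall p'-subgroup [Q] of [N] centralises the p-group [M], so it is
    normal in [M <*> Q]. That join is normal in [T]: it equals [N] in the coprime case, and in the
    other case [N / M] is central. So [Q] falls into the trivial p'-core. *)
Lemma pi_hypercentral_pcore1 (gT : finGroupType) (T N : {group gT}) (p : nat) :
    solvable T -> prime p -> p \in pi -> 'O_p^'(T) = 1 ->
  pi_hypercentral pi T T N -> p.-group N.
Proof.
move=> solT pr_p pi_p O1 hypN; elim: hypN => [|{}M {}N hypM pM sMN nsNT step].
  exact: pgroup1.
have nsMT := pi_hypercentral_normal hypM; have sNT := normal_sub nsNT.
have [Q hallQ] := Hall_exists p^' (solvableS sNT solT).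
have [sQN p'Q _] := and3P hallQ; have sQT := subset_trans sQN sNT.
have cMQ := pi_hypercentral_p'subgroup hypM pM pi_p sQT (subxx T) p'Q.
have nMT := normal_norm nsMT; have nMN := subset_trans sNT nMT.
have nMQ := subset_trans sQT nMT.
have nsMQT : M <*> Q <| T.
  case: step => [pi'NM | sNTM].
    suff -> : M <*> Q = N by [].
    apply/eqP; rewrite eqEsubset join_subG sMN sQN norm_joinEr //=.
    rewrite -quotientSK //.
    have hallQM := quotient_pHall nMQ hallQ; rewrite -(pHall_id hallQM) //.
    rewrite /pgroup card_quotient //.
    by apply: sub_in_pnat pi'NM => q _; apply: contraNneq => ->.
  rewrite /normal join_subG (normal_sub nsMT) sQT /= -commg_subl.
  apply: subset_trans (joing_subl M Q); apply: subset_trans sNTM.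
  by rewrite commSg // join_subG sMN.
have nsQ : Q <| M <*> Q.
  by rewrite /normal joing_subr join_subG normG cents_norm // centsC.
have sQO : Q \subset 'O_p^'(M <*> Q) by apply: pcore_max.
have: Q \subset 'O_p^'(T).
  apply: subset_trans sQO _; apply: pcore_max (pcore_pgroup _ _) _.
  exact: gFnormal_trans.
rewrite O1 => /trivgP Q1.
have := card_Hall hallQ; rewrite Q1 cards1 => /esym/eqP.
by rewrite partG_eq1 /pgroup (eq_pnat _ (negnK _)).
Qed.

Lemma pi_hypercentral_nilpotent (gT : finGroupType) (T : {group gT}) :
  nilpotent T -> pi_hypercentral pi T T T.
Proof.
case/ucnP=> n defT.
suff: pi_hypercentral pi T T 'Z_n(T)%G.
  by congr (pi_hypercentral _ _ _ _); apply/val_inj.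
elim: n {defT} => [|n IHn].
  rewrite (_ : 'Z_0(T)%G = 1%G); first exact: pi_hypercentral1.
  exact/val_inj/ucn0.
apply: (pi_hypercentralS IHn); rewrite /= ?ucn_normal ?ucn_subS //.
by right; apply: ucn_comm.
Qed.

Lemma pi_hypercentral_pi'group (gT : finGroupType) (G R N : {group gT}) :
  N <| G -> pi^'.-group N -> pi_hypercentral pi G R N.
Proof.
move=> nsNG pi'N; apply: (pi_hypercentralS (pi_hypercentral1 pi G R)) => //.
  exact: sub1G.
by left; rewrite indexg1.
Qed.

Lemma pi_hypercentral_pi_nilpotent (gT : finGroupType) (T : {group gT}) :
  pi_nilpotent_groups pi T -> pi_hypercentral pi T T T.
Proof.
move=> nilT; apply: (pi_hypercentral_ext (M := 'O_pi^'(T)%G)) => //.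
  by apply: pi_hypercentral_pi'group; rewrite ?pcore_normal ?pcore_pgroup.
exact: pi_hypercentral_nilpotent.
Qed.

Lemma pi_nilpotent_pi_hypercentral (gT : finGroupType) (T : {group gT}) :
  solvable T -> pi_hypercentral pi T T T -> pi_nilpotent_groups pi T.
Proof.
move=> solT hypT; apply/pi_nilpotentP=> p pr_p pi_p.
have nOT := normal_norm (pcore_normal p^' T).
have hypTO := pi_hypercentral_morphim (coset_morphism 'O_p^'(T)) nOT
  (subxx T) hypT.
apply: pi_hypercentral_pcore1 pr_p pi_p _ hypTO; first exact: quotient_sol.
exact: trivg_pcore_quotient.
Qed.

(** The detour through series pays off because they restrict to subgroups; solvability is what
    permits the return from series to pi-nilpotency. *)
Lemma pi_nilpotentS (gT : finGroupType) (T A : {group gT}) :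
    solvable T -> A \subset T -> pi_nilpotent_groups pi T ->
  pi_nilpotent_groups pi A.
Proof.
move=> solT sAT /pi_hypercentral_pi_nilpotent hypT.
apply: pi_nilpotent_pi_hypercentral; first exact: solvableS solT.
exact: (pi_hypercentral_sub hypT).
Qed.

Lemma pi_nilpotent_homg (aT rT : finGroupType) (T : {group aT})
    (S : {group rT}) :
  S \homg T -> pi_nilpotent_groups pi T -> pi_nilpotent_groups pi S.
Proof.
case/homgP=> f defS; rewrite /pi_nilpotent_groups => nilT.
have nOS := morphim_normal f (pcore_normal pi^' T).
have sOS : f @* 'O_pi^'(T) \subset 'O_pi^'(S).
  by rewrite pcore_max ?morphim_pgroup ?pcore_pgroup // -defS.
have nSO : S \subset 'N(f @* 'O_pi^'(T)) by rewrite -defS normal_norm.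
have homS := homg_quotientS nSO (normal_norm (pcore_normal pi^' S)) sOS.
have homT : S / (f @* 'O_pi^'(T)) \homg T / 'O_pi^'(T).
  apply/homgP; exists (quotm_morphism f (pcore_normal pi^' T)).
  by rewrite /= morphim_quotm defS.
case/homgP: (homg_trans homS homT) => g <-; exact: morphim_nil.
Qed.

End PiNilpotent.

(** The Frattini argument gives [V = Y * 'N_V(Q)], hence [V = N * 'N_V(Q)]; as [N] has no proper
    supplement, [Q] is normal in [V]. *)
Lemma Frattini_Hall_normal (gT : finGroupType) (sigma : nat_pred)
    (V Y N Q : {group gT}) :
    solvable Y -> Y <| V -> sigma.-Hall(Y) Q -> Y \subset N * Q ->
    (forall M : {group gT}, M \subset V -> V \subset N * M -> M = V) ->
  Q <| V.
Proof.
move=> solY nsYV hallQ sYNQ noSup; have sQY := pHall_sub hallQ.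
have sQV := subset_trans sQY (normal_sub nsYV).
have defV := Hall_Frattini_arg solY nsYV hallQ.
suff /(congr1 val)/= defN : 'N_V(Q)%G = V.
  by rewrite /normal sQV -{1}defN subsetIr.
apply: noSup; first exact: subsetIl.
have sQN : Q \subset 'N_V(Q) by rewrite subsetI sQV normG.
have -> : N * 'N_V(Q) = N * Q * 'N_V(Q) by rewrite -mulgA (mulSGid sQN).
by rewrite -{1}defV mulSg.
Qed.

(** * Supplements *)

Lemma p_nilpotent_pcore_Hall (gT : finGroupType) (T : {group gT}) (p : nat) :
  p.-group (T / 'O_p^'(T)) = p^'.-Hall(T) 'O_p^'(T).
Proof.
rewrite /pHall pcore_sub pcore_pgroup /pgroup card_quotient ?gFnorm //.
by rewrite (eq_pnat _ (negnK _)).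
Qed.

Section ResidualProduct.

Variables (pi : nat_pred) (F : group_class).
Hypotheses (formF : formation F) (subF : subgroup_closed F).

Local Notation npF := (residual_product (pi_nilpotent_groups pi) F).

Lemma npF_homg (aT rT : finGroupType) (G : {group aT}) (H : {group rT}) :
  H \homg G -> npF G -> npF H.
Proof.
case/homgP=> f defH; apply: pi_nilpotent_homg; apply/homgP.
have <- : (f @* G)%G = H by apply/val_inj.
exists (restrm_morphism (residual_sub formF G) f).
by rewrite morphim_restrm setIid /= residual_morphim.
Qed.

Lemma npFS (gT : finGroupType) (G H : {group gT}) :
  solvable G -> H \subset G -> npF G -> npF H.
Proof.
move=> solG sHG; apply: pi_nilpotentS (residualS formF subF sHG).
exact: solvableS (residual_sub formF G) solG.
Qed.

(* Minimality of V makes V :&: K behave like a Frattini subgroup of V. *)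
Lemma npF_supplement (gT : finGroupType) (G K : {group gT}) :
    solvable G -> K <| G -> npF (G / K)%G ->
  exists V : {group gT}, [/\ V \subset G, K * V = G & npF V].
Proof.
move=> solG nsKG npGK.
pose P (V : {group gT}) := (V \subset G) && (G \subset K * V).
have PG : P G by rewrite /P subxx mulG_subr.
have [V /mingroupP[/andP[sVG sGKV] minV] _] := mingroup_exists PG.
have nKG := normal_norm nsKG; have nKV := subset_trans sVG nKG.
have defG : K * V = G.
  by apply/eqP; rewrite eqEsubset sGKV mul_subG ?(normal_sub nsKG).
exists V; split=> //.
set N := (K :&: V)%G; have nsNV : N <| V by rewrite /= setIC norm_normalI.
have noSup (M : {group gT}) : M \subset V -> V \subset N * M -> M = V.
  move=> sMV sVNM; apply/val_inj/minV => //; rewrite /P (subset_trans sMV) //=.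
  rewrite -{1}defG (subset_trans (mulgS K sVNM)) // mulgA mulSg //.
  by rewrite -{2}(mulGid K) mulgS ?subsetIl.
have npVN : npF (V / N)%G.
  apply: npF_homg npGK; apply: homg_trans (isog_hom (second_isog nKV)) _.
  rewrite /=; have -> : V / K = G / K by rewrite -defG quotientMidl.
  exact: homg_refl.
set T := residual_group F V; have nsTV : T <| V := residual_normal formF V.
have sTV := normal_sub nsTV; have solV := solvableS sVG solG.
have nNT := subset_trans sTV (normal_norm nsNV).
apply/pi_nilpotentP=> p pr_p pi_p.
have := npVN; rewrite /residual_product => /pi_nilpotentP/(_ p pr_p pi_p).
have -> : residual_group F (V / N) = (T / N)%G.
  by apply/val_inj; rewrite /= residual_quotient ?normal_norm.
rewrite p_nilpotent_pcore_Hall => hallO.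
(* [Y] is [N] times any of its Hall p'-subgroups, so such a subgroup [Q] is normal in [V] by the
   Frattini argument. *)
set Y := (coset N @*^-1 'O_p^'(T / N))%G.
have nsYV : Y <| V.
  rewrite -(quotientGK nsNV) cosetpre_normal gFnormal_trans //.
  exact: quotient_normal.
have solY := solvableS (normal_sub nsYV) solV.
have [Q hallQ] := Hall_exists p^' solY; have [sQY p'Q _] := and3P hallQ.
have nNY : Y \subset 'N(N) by apply: subsetIl.
have sYNQ : Y \subset N * Q.
  rewrite -quotientSK //.
  have hallQN := quotient_pHall (subset_trans sQY nNY) hallQ.
  by rewrite (pHall_id hallQN) // /= cosetpreK pcore_pgroup.
have nsQV := Frattini_Hall_normal solY nsYV hallQ sYNQ noSup.
(* It remains to see that a Hall p'-subgroup of [T] lies in the p'-core of [T]: it lies in [Y],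
   hence in [Q], and [T :&: Q] is a normal p'-subgroup of [T]. *)
have [Q2 hallQ2] := Hall_exists p^' (solvableS sTV solV).
have [sQ2T p'Q2 p_ind] := and3P hallQ2.
have sQ2Y : Q2 \subset Y.
  rewrite -sub_morphim_pre ?(subset_trans sQ2T) //= -quotientE.
  rewrite (sub_normal_Hall hallO) ?pcore_normal ?quotientS //.
  exact: quotient_pgroup.
have nsQY : Q <| Y by apply: normalS (normal_sub nsYV) nsQV.
have sQ2Q : Q2 \subset Q by rewrite (sub_normal_Hall hallQ).
have sQ2O : Q2 \subset 'O_p^'(T).
  have sQ2TQ : Q2 \subset T :&: Q by rewrite subsetI sQ2T.
  apply: subset_trans sQ2TQ _; apply: pcore_max.
    exact: pgroupS (subsetIr _ _) p'Q.
  exact: normalGI sTV nsQV.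
rewrite p_nilpotent_pcore_Hall /pHall pcore_sub pcore_pgroup /=.
exact: pnat_dvd (indexgS T sQ2O) p_ind.
Qed.

End ResidualProduct.

(** * Normal p-subgroups normalising the residuals *)

Section PgroupAction.

Variables (gT : finGroupType) (p : nat).
Implicit Types A G L P Q R : {group gT}.

Lemma p'group_cent_index A P Q :
    A \subset 'N(P) -> p.-nat #|A : 'C(P)| -> Q \subset A -> p^'.-group Q ->
  Q \subset 'C(P).
Proof.
move=> nPA p_ind sQA p'Q; rewrite -indexg_eq1.
apply/eqP/(@pnat_1 p); last exact: pnat_dvd (dvdn_indexg _ _) p'Q.
have nsCA : 'C_A(P) <| A by rewrite norm_normalI // norms_cent.
apply: pnat_dvd p_ind; have := index_norm_dvd sQA nsCA.
by rewrite indexgI -[#|Q : 'C_A(P)|]indexgI setIA (setIidPl sQA) indexgI.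
Qed.

Lemma Hall_cent_index A P Q :
  p^'.-Hall(A) Q -> Q \subset 'C(P) -> p.-nat #|A : 'C(P)|.
Proof.
case/and3P=> sQA _ pA cPQ; rewrite (eq_pnat _ (negnK _)) in pA.
exact: pnat_dvd (indexgS A cPQ) pA.
Qed.

(** [R] is ['C_R(L)] times a Sylow p-subgroup [Q]. In the p-group [L <*> Q] the normal subgroup [L]
    meets the center, so ['C_L(R)] is nontrivial; it is [G]-invariant, hence all of [L]. *)
Lemma minnormal_pgroup_cent G L R :
    minnormal L G -> p.-group L -> R <| G -> p.-nat #|R : 'C(L)| ->
  R \subset 'C(L).
Proof.
case/mingroupP=> /andP[ntL nLG] minL pL nsRG p_ind.
have [sRG nRG] := andP nsRG; have nLR := subset_trans sRG nLG.
have [Q sylQ] := Sylow_exists p R; have [sQR pQ _] := and3P sylQ.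
have nLQ := subset_trans sQR nLR.
have nCR : R \subset 'N('C_R(L)) by rewrite normsI ?normG ?norms_cent.
have sRCQ : R \subset 'C_R(L) * Q.
  rewrite -quotientSK //.
  have sylQC := quotient_pHall (subset_trans sQR nCR) sylQ.
  by rewrite (pHall_id sylQC) // /pgroup card_quotient // indexgI.
have pLQ : p.-group (L <*> Q) by rewrite norm_joinEr // pgroupM pL.
have nsL : L <| L <*> Q by rewrite /normal joing_subl join_subG normG.
have ntZ := meet_center_nil (pgroup_nil pLQ) nsL ntL.
have sZC : L :&: 'Z(L <*> Q) \subset 'C_L(R).
  rewrite subsetI subsetIl (subset_trans _ (centS sRCQ)) // centM subsetI.
  apply/andP; split.
    by apply: subset_trans (subsetIl _ _) _; rewrite centsC subsetIr.
  apply: subset_trans (subsetIr _ _) (subset_trans (subsetIr _ _) _).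
  by rewrite centS ?joing_subr.
have /minL : ('C_L(R) != 1) && (G \subset 'N('C_L(R))).
  rewrite normsI ?norms_cent ?andbT //; apply: contraNneq ntZ => C1.
  by rewrite -subG1 -C1.
by move/(_ (subsetIl _ _))/setIidPl; rewrite centsC.
Qed.

End PgroupAction.

Section NormAction.

Variable F : group_class.
Hypotheses (formF : formation F) (subF : subgroup_closed F).

(** The induction is on [#|G| + #|P|] because one reduction shrinks [G] and the other shrinks [P].
    Once proper subgroups are settled, a Frattini argument works in a minimal normal [Y] that
    contains ['C_G(P)] and covers the residual up to p-power index. *)
Lemma residual_pgroup_action (gT : finGroupType) (p : nat) (G P : {group gT}) :
    solvable G -> P <| G -> p.-group P ->
    (forall H : {group gT}, H \subset G -> P \subset 'N(residual F H)) ->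
  p.-nat #|residual F G : 'C(P)|.
Proof.
have [n] := ubnP (#|G| + #|P|); elim: n => // n IHn in G P *.
rewrite ltnS => len solG nsPG pP nFP; have [sPG nPG] := andP nsPG.
(* If M P = G then M^F is normal in G and meets P in a smaller subgroup;
   otherwise M P is a smaller group. *)
have proper_case (M : {group gT}) :
  M \proper G -> p.-nat #|residual F M : 'C(P)|.
- move=> ltMG; have sMG := proper_sub ltMG.
  set D := residual_group F M; have nsDM : D <| M := residual_normal formF M.
  have sDM := normal_sub nsDM; have nPD : D \subset 'N(P).
    by rewrite (subset_trans sDM) ?(subset_trans sMG).
  have solD : solvable D by rewrite (solvableS sDM) ?(solvableS sMG).
  have [Q hallQ] := Hall_exists p^' solD; have [sQD p'Q _] := and3P hallQ.
  have nPQ := subset_trans sQD nPD.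
  apply: Hall_cent_index hallQ _.
  have sMPG : M <*> P \subset G by rewrite join_subG sMG.
  have [defG | ltMPG] := eqVproper sMPG; last first.
    have sPMP := joing_subr M P.
    have: p.-nat #|residual F (M <*> P) : 'C(P)|.
      apply: IHn => //; first last.
      - by move=> H sH; apply: nFP; apply: subset_trans sMPG.
      - exact: normalS nsPG.
      - exact: solvableS solG.
      by apply: leq_trans len; rewrite ltn_add2r proper_card.
    move/p'group_cent_index; apply=> //.
      by rewrite (subset_trans (residual_sub formF _)) ?(subset_trans sMPG).
    by rewrite (subset_trans sQD) ?residualS ?joing_subl.
  (* [M] normalises its own residual [D], and [P] does so by hypothesis. *)
  have nsDG : D <| G.
    by rewrite /normal (subset_trans sDM) // -defG join_subG normal_norm ?nFP.
  pose P1 := (P :&: D)%G; have nsP1G : P1 <| G by apply: normalI.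
  have sP1P : P1 \subset P := subsetIl P D.
  have ltP1P : P1 \proper P.
    rewrite properE sP1P; apply: contraL (ltMG) => sPP1; rewrite -defG.
    have sPM : P \subset M.
      by rewrite (subset_trans sPP1) ?(subset_trans _ sDM) ?subsetIr.
    by rewrite (joing_idPl sPM) properxx.
  have p1P1 : p.-nat #|residual F G : 'C(P1)|.
    apply: IHn => //; last by move=> H sHG; rewrite (subset_trans sP1P) ?nFP.
      by apply: leq_trans len; rewrite ltn_add2l proper_card.
    exact: pgroupS pP.
  have nP1Q : Q \subset 'N(P1).
    rewrite (subset_trans sQD) ?(subset_trans sDM) ?(subset_trans sMG) //.
    exact: normal_norm.
  have cP1Q : Q \subset 'C(P1).
    apply: (p'group_cent_index _ p1P1) p'Q.
      by rewrite (subset_trans (residual_sub formF _)) ?normal_norm.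
    by rewrite (subset_trans sQD) ?residualS.
  have coP1Q : coprime #|P1| #|Q| by apply: pnat_coprime (pgroupS sP1P pP) p'Q.
  have solP1 := pgroup_sol (pgroupS sP1P pP).
  (* [P] and [Q] both normalise [D] and [P], so the commutator of [P] and [Q] lies in [P1]. As [Q]
     also centralises [P1], coprime action makes it centralise [P]. *)
  have := coprime_norm_quotient_cent nPQ nP1Q coP1Q solP1.
  have nP1P : P \subset 'N(P1) by rewrite (subset_trans sPG) ?normal_norm.
  have /setIidPl -> : P / P1 \subset 'C(Q / P1).
    rewrite quotient_cents2 // subsetI commg_subl nPQ.
    by rewrite (subset_trans (commgS _ sQD)) // commg_subr nFP.
  move/quotient_inj=> defP; rewrite centsC; apply/setIidPl/defP.
    by rewrite /normal subsetI sP1P centsC cP1Q (subset_trans (subsetIl _ _)).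
  by rewrite /normal sP1P.
have [sTG nTG] := andP (residual_normal formF G).
set T := residual_group F G in sTG nTG *.
pose C := ('C_G(P))%G; have nsCG : C <| G.
  by rewrite norm_normalI ?norms_cent.
have -> : #|T : 'C(P)| = #|T : C|.
  by rewrite -[RHS]indexgI /= setIA (setIidPl sTG) indexgI.
have trans_index (X Y : {group gT}) :
  X <| Y -> p.-nat #|Y : X| -> p.-nat #|T : Y| -> p.-nat #|T : X|.
- move=> nsXY pYX pTY; rewrite -indexgI.
  rewrite -(Lagrange_index (subsetIl T Y) (setIS _ (normal_sub nsXY))).
  rewrite pnatM indexgI pTY; apply: pnat_dvd pYX.
  have := index_norm_dvd (subsetIr T Y) nsXY.
  by rewrite -[#|T :&: Y : X|]indexgI -setIA (setIidPr (normal_sub nsXY)).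
(* For Y minimal, a normal subgroup N of G with Y / N a p'-chief factor has no
   proper supplement, so the Hall p'-subgroups of Y are normal in G. *)
pose goodY (Y : {group gT}) := [&& C \subset Y, Y <| G & p.-nat #|T : Y|].
have goodG : goodY G.
  rewrite /goodY normal_refl subsetIl (_ : #|T : G| = 1%N) //.
  by apply/eqP; rewrite indexg_eq1.
have [Y /mingroupP[/and3P[sCY nsYG pTY] minY] _] := mingroup_exists goodG.
have [sYG nYG] := andP nsYG.
have nsCY : C <| Y by apply: normalS nsCG.
apply: (trans_index C Y _ _ pTY) => //.
have [-> | neqYC] := eqVneq Y C; first by rewrite indexgg.
have ltCY : (C \proper Y) && (G \subset 'N(C)).
  rewrite normal_norm // andbT properEneq sCY andbT.
  by apply: contraNneq neqYC => eqCY; apply/eqP/val_inj; rewrite /= eqCY.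
have [N maxN sCN] := maxgroup_exists (gP := fun N => (N \proper Y) && _) ltCY.
have /maxgroupP[/andP[ltNY nNG] _] := maxN; have sNY := proper_sub ltNY.
have nsNG : N <| G by rewrite /normal (subset_trans sNY).
have nsNY : N <| Y by apply: normalS nsNG.
(* By minimality of [Y] the index of [N] in [T] fails to be a p-power; hence the prime [q] of the
   chief factor [Y / N] differs from [p]. *)
have notNgood : ~~ p.-nat #|T : N|.
  apply: contraL (ltNY) => pTN; rewrite (minY N) ?properxx //.
  by rewrite /goodY sCN nsNG.
have chiefY : chief_factor G N Y by apply/andP; split.
have minYN := chief_factor_minnormal chiefY.
have solGN : solvable (G / N) := quotient_sol N solG.
have [_ _ /is_abelemP[q pr_q /and3P[qYN _ _]]] :=
  minnormal_solvable minYN (quotientS N sYG) solGN.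
rewrite /pgroup card_quotient ?normal_norm // in qYN.
have p'YN : p^'.-nat #|Y : N|.
  apply: (sub_in_pnat _ qYN) => r _; rewrite !inE => /eqP->.
  apply: contra notNgood => /eqP eq_qp.
  by apply: (trans_index N Y _ _ pTY) => //; rewrite -eq_qp.
have solY := solvableS sYG solG.
have [Q hallQ] := Hall_exists p^' solY; have [sQY p'Q p_ind] := and3P hallQ.
have nNY := normal_norm nsNY.
have sYNQ : Y \subset N * Q.
  rewrite -quotientSK //.
  have hallQN := quotient_pHall (subset_trans sQY nNY) hallQ.
  by rewrite (pHall_id hallQN) // /pgroup card_quotient.
(* If a proper [M] supplements [N], then [M] and [G] have the same image modulo [N], and so do their
   residuals. The case of proper subgroups then makes [#|T : N|] a p-power, since [C] lies in
   [N]. *)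
have noSup (M : {group gT}) : M \subset G -> G \subset N * M -> M = G.
  move=> sMG sGNM; apply/eqP; apply: contraNT notNgood => neqMG.
  have ltMG : M \proper G by rewrite properEneq sMG andbT.
  have nNM : M \subset 'N(N) := subset_trans sMG nNG.
  have eqMG : (M / N = G / N)%G.
    apply/val_inj/eqP; rewrite /= eqEsubset quotientS // quotientSK //.
  have sMF := residual_sub formF M.
  have : T / N = residual F M / N.
    by rewrite -!residual_quotient // eqMG.
  move/(congr1 (fun A : {set coset_of N} => #|A|)).
  rewrite !card_quotient ?(subset_trans sTG) ?(subset_trans sMF) // => ->.
  apply: pnat_dvd (proper_case M ltMG); rewrite -indexgI -[X in _ %| X]indexgI.
  apply: indexgS; apply: subset_trans (setIS _ sCN).
  by rewrite /= setIA (setIidPl (subset_trans sMF sMG)).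
have nsQG := Frattini_Hall_normal solY nsYG hallQ sYNQ noSup.
(* [Q] and [P] are normal of coprime orders, so they commute; [C] then contains a Hall p'-subgroup
   of [Y]. *)
have sQC : Q \subset C.
  rewrite subsetI (normal_sub nsQG) (sameP commG1P trivgP).
  have <- : Q :&: P = 1.
    by rewrite setIC; apply: coprime_TIg; apply: pnat_coprime pP p'Q.
  rewrite subsetI commg_subl commg_subr (subset_trans sPG (normal_norm nsQG)).
  exact: subset_trans (normal_sub nsQG) nPG.
rewrite (eq_pnat _ (negnK _)) in p_ind.
exact: pnat_dvd (indexgS Y sQC) p_ind.
Qed.

End NormAction.

(** * The hyper-norm *)

Section HyperNorm.

Variables (pi : nat_pred) (F : group_class).
Hypotheses (formF : formation F) (subF : subgroup_closed F).

Lemma minnormal_pi_hypercentral (gT : finGroupType) (G L R : {group gT})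
    (p : nat) :
    minnormal L G -> L \subset G -> p.-group L -> prime p -> R <| G ->
    (p \in pi -> p.-nat #|R : 'C(L)|) ->
  pi_hypercentral pi G R L.
Proof.
move=> minL sLG pL pr_p nsRG p_ind.
have [/andP[_ nLG] _] := mingroupP minL.
have nsLG : L <| G by rewrite /normal sLG.
have [pi_p | pi'p] := boolP (p \in pi); last first.
  by apply: pi_hypercentral_pi'group; rewrite // (pi_pgroup pL).
apply: (pi_hypercentralS (pi_hypercentral1 pi G R)); rewrite ?sub1G //.
right; rewrite (sameP trivgP commG1P) centsC.
exact: minnormal_pgroup_cent minL pL nsRG (p_ind pi_p).
Qed.

Lemma residual_normalizer_quotient (gT : finGroupType) (G K N : {group gT}) :
    K <| G -> N \subset G ->
    (forall H : {group gT}, H \subset G ->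
      N \subset 'N(residual F H * 'O_pi^'(G))) ->
  forall H : {group coset_of K}, H \subset G / K ->
    N / K \subset 'N(residual F H * 'O_pi^'(G / K)).
Proof.
move=> nsKG sNG nNF H sHG; have nKG := normal_norm nsKG.
have [H0 /= sH0G defH] : exists2 H0 : {group gT}, H0 \subset G & H = (H0 / K)%G.
  exists (coset K @*^-1 H)%G; last by apply/val_inj; rewrite /= cosetpreK.
  by rewrite -(quotientGK nsKG) morphpreS.
have nKH := subset_trans sH0G nKG.
rewrite defH residual_quotient //.
(* The image of the pi'-core may be smaller than the pi'-core of [G / K], so the missing part is
   multiplied in; [N / K] normalises it in any case. *)
have sO : 'O_pi^'(G) / K \subset 'O_pi^'(G / K) by apply: morphim_pcore.
rewrite -(mulSGid sO) mulgA normsM //.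
  rewrite -quotientMl ?(subset_trans (residual_sub formF _)) //.
  exact: quotient_norms (nNF _ sH0G).
by rewrite (subset_trans (quotientS K sNG)) ?gFnorm.
Qed.

(** Induction on [#|G|]: a nontrivial pi'-core is factored out first. Once it is trivial, [N]
    normalises the residuals themselves, so the residual of [G] acts as a p-group on a minimal
    normal subgroup [L] below [N], hence trivially, and [L] is factored out. *)
Lemma residual_normalizer_hypercentral (gT : finGroupType) (G N : {group gT}) :
    solvable G -> N <| G ->
    (forall H : {group gT}, H \subset G ->
      N \subset 'N(residual F H * 'O_pi^'(G))) ->
  pi_hypercentral pi G (residual_group F G) N.
Proof.
have [n] := ubnP #|G|; elim: n => // n IHn in gT G N *.
rewrite ltnS => leGn solG nsNG nNF; have [sNG nNG] := andP nsNG.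
have sTG := residual_sub formF G.
have quo (K : {group gT}) : K <| G -> K :!=: 1 ->
    pi_hypercentral pi G (residual_group F G) K ->
  pi_hypercentral pi G (residual_group F G) N.
- move=> nsKG ntK hypK; apply: (pi_hypercentral_ext sTG nsNG hypK).
  have -> : (residual_group F G / K = residual_group F (G / K))%G.
    by apply/val_inj; rewrite /= residual_quotient ?normal_norm.
  apply: IHn; rewrite ?quotient_sol ?quotient_normal //.
    by apply: leq_trans leGn; rewrite ltn_quotient ?normal_sub.
  exact: residual_normalizer_quotient.
have [O1 | ntO] := eqVneq 'O_pi^'(G) 1; last first.
  apply: (quo 'O_pi^'(G)%G) ntO _; first exact: pcore_normal.
  by apply: pi_hypercentral_pi'group; rewrite ?pcore_normal ?pcore_pgroup.
have [-> | ntN] := eqVneq N 1%G; first exact: pi_hypercentral1.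
have [L minL sLN] := minnormal_exists ntN nNG.
have sLG := subset_trans sLN sNG.
have [_ ntL /is_abelemP[p pr_p /and3P[pL _ _]]] :=
  minnormal_solvable minL sLG solG.
have nsLG : L <| G by case/mingroupP: minL => /andP[_ nLG] _; apply/andP.
apply: (quo L) ntL _ => //.
apply: (minnormal_pi_hypercentral minL sLG pL pr_p (residual_normal formF G)).
move=> _; apply: residual_pgroup_action => // H sHG.
by apply: subset_trans sLN _; have := nNF H sHG; rewrite O1 mulg1.
Qed.

Lemma norm_subgroup_normal (gT : finGroupType) (G : {group gT}) :
  norm_subgroup pi F G <| G.
Proof.
apply/andP; split.
  exact: subset_trans (bigcap_inf G (subxx _)) (subsetIl _ _).
apply/subsetP=> g Gg; rewrite inE; apply/bigcapsP=> H sHG.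
rewrite sub_conjg conjIg -normJ conjsMg conjGid ?groupV //.
rewrite -pcoreJ conjGid ?groupV // -residualJ //.
by apply: (bigcap_inf (H :^ g^-1)%G); rewrite sub_conjgV conjGid.
Qed.

Lemma norm_series_hypercentral (gT : finGroupType) (G : {group gT}) n :
    solvable G ->
  pi_hypercentral pi G (residual_group F G) (norm_series pi F G n).
Proof.
move=> solG; elim: n => [|n IHn]; first exact: pi_hypercentral1.
set K := norm_series pi F G n in IHn *.
have nsKG := pi_hypercentral_normal IHn; have sTG := residual_sub formF G.
have -> : norm_series pi F G n.+1
    = (coset K @*^-1 norm_subgroup pi F (G / K))%G by [].
apply: (pi_hypercentral_ext sTG _ IHn).
  by rewrite -(quotientGK nsKG) cosetpre_normal norm_subgroup_normal.
have -> : (residual_group F G / K = residual_group F (G / K))%G.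
  by apply/val_inj; rewrite /= residual_quotient ?normal_norm.
have -> : ((coset K @*^-1 norm_subgroup pi F (G / K)) / K
    = norm_subgroup_group pi F (G / K))%G.
  by apply/val_inj; rewrite /= cosetpreK.
apply: residual_normalizer_hypercentral; first exact: quotient_sol.
  exact: norm_subgroup_normal.
by move=> H sHG; apply: subset_trans (bigcap_inf H sHG) (subsetIr _ _).
Qed.

(** Climbing the series of [N] modulo the hyper-norm [K], each new factor either lies in the
    pi'-core of [G / K] or centralises the residual of [G / K] and so every residual below it. In
    both cases it lies in the norm of [G / K], whose preimage is [K]. *)
Lemma hypercentral_sub_hyper_norm (gT : finGroupType) (G N : {group gT}) :
    solvable G -> pi_hypercentral pi G (residual_group F G) N ->
  N \subset hyper_norm pi F G.
Proof.
move=> solG hypN; set K := hyper_norm pi F G.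
(* The series is already stationary one step after index [#|G|]. *)
have defK : coset K @*^-1 norm_subgroup pi F (G / K) = K.
  by have /(congr1 (@gval gT)) := norm_series_stable pi F (leqnSn #|G|).
have nsKG : K <| G := pi_hypercentral_normal (norm_series_hypercentral _ solG).
have nKG := normal_norm nsKG.
elim: hypN => [|{}M {}N hypM sMK sMN nsNG step]; first exact: sub1G.
have sNG := normal_sub nsNG; have nKN := subset_trans sNG nKG.
have sTG := residual_sub formF G.
rewrite -defK -sub_morphim_pre //= -quotientE; apply/bigcapsP=> H sHG.
rewrite subsetI quotientS //=.
have nOH : residual F H \subset 'N('O_pi^'(G / K)).
  by rewrite (subset_trans (residual_sub formF H)) ?(subset_trans sHG) ?gFnorm.
case: step => [pi'NM | sNTM].
  have sNO : N / K \subset 'O_pi^'(G / K).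
    rewrite pcore_max ?quotient_normal // /pgroup card_quotient //.
    by apply: pnat_dvd pi'NM; apply: indexgS.
  rewrite -norm_joinEl //; apply: subset_trans sNO (subset_trans _ (normG _)).
  exact: joing_subr.
rewrite normsM //; last by rewrite (subset_trans (quotientS K sNG)) ?gFnorm.
rewrite cents_norm // (subset_trans _ (centS (residualS formF subF sHG))) //.
rewrite residual_quotient // quotient_cents2 ?(subset_trans sTG) //.
exact: subset_trans sNTM sMK.
Qed.

End HyperNorm.

(** * Central chief factors and the hypercenter *)

Lemma chief_cent_normal (gT : finGroupType) (G K L : {group gT}) :
  chief_factor G K L -> 'C_G(L / K | 'Q) <| G.
Proof.
case/andP=> /maxgroupP[/andP[_ nKG] _] nsLG.
rewrite astabQ norm_normalI //.
apply: subset_trans (morphpre_norm _ _).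
rewrite -sub_morphim_pre //= -quotientE norms_cent ?quotient_norms //.
exact: normal_norm.
Qed.

Lemma chief_actsE (gT : finGroupType) (G K L : {group gT})
    (LK : chief_factor G K L) w g :
  w \in L / K -> g \in G ->
  <[chief_acts LK]>%gact w (coset 'C_G(L / K | 'Q) g) = w ^ coset K g.
Proof.
move=> Lw Gg; have nsCG := chief_cent_normal LK.
have [/maxgroupP[/andP[ltKL nKG] _] nsLG] := andP LK.
have nKg := subsetP nKG g Gg.
rewrite /= actbyE ?mem_quotient //.
apply: etrans (modactE _ _ _) _.
- by rewrite /= dom_qactJ.
- by apply: subsetP Gg; apply: normal_norm.
- apply/afixP=> c /setIP[_ /setIP[_ cLKc]].
  by apply: (astab_act cLKc).
by rewrite /= qactJ nKg.
Qed.

Section CentralFactor.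

Variable F : group_class.
Hypotheses (formF : formation F) (subF : subgroup_closed F).

(** Forwards, [V] and the residual of [X] both lie in the Fitting subgroup of [X], and minimality
    puts [V] in its center. Backwards, the residual of [G] lies in [C], so [X / V] is in [F] and the
    residual of [X] lies in the abelian [V]. *)
Lemma central_factorP (gT : finGroupType) (G K L : {group gT})
    (LK : chief_factor G K L) : solvable G ->
  Defs.central_factor (residual_product nilpotent_groups F) LK <->
  [~: L, residual F G] \subset K.
Proof.
move=> solG; have nsCG := chief_cent_normal LK.
have minLK := chief_factor_minnormal LK.
have [/maxgroupP[/andP[ltKL nKG] _] nsLG] := andP LK.
have [sLG nLG] := andP nsLG.
have sTG := residual_sub formF G.
have [_ _ abLK] :=
  minnormal_solvable minLK (quotientS K sLG) (quotient_sol K solG).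
have {}abLK : abelian (L / K) by case/is_abelemP: abLK => q _ /and3P[].
rewrite /Defs.central_factor /residual_product /nilpotent_groups.
set to := <[chief_acts LK]>%gact; set X := [set: sdprod_by to]%G.
set C := ('C_G(L / K | 'Q))%G in nsCG to X *.
have nCG := normal_norm nsCG.
set V := (sdpair1 to @* (L / K))%G; set D := (sdpair2 to @* (G / C))%G.
have defX : V * D = X := im_sdpair to.
have nVD : D \subset 'N(V) := im_sdpair_norm to.
have sVX : V \subset X by rewrite subsetT.
have sDX : D \subset X by rewrite subsetT.
have nsVX : V <| X.
  by rewrite /normal sVX -defX mul_subG ?normG.
have cVV : abelian V by rewrite morphim_abelian.
have resD : residual F D = sdpair2 to @* (residual F G / C).
  by rewrite -residual_quotient // residual_morphim.
split=> [nilS | sLTK].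
  set S := residual_group F X in nilS.
  have nsSX : S <| X := residual_normal formF X.
  have [sVF sSF] : V \subset 'F(X) /\ S \subset 'F(X).
    by split; apply: Fitting_max => //; apply: abelian_nil.
  have nsVF : V <| 'F(X) := normalS sVF (subsetT _) nsVX.
  (* The part of [V] central in the Fitting subgroup is pulled back to [L / K], where minimality
     under [G] applies. *)
  set W := (sdpair1 to @*^-1 'Z('F(X)) :&: (L / K))%G.
  have ntV : V :!=: 1.
    rewrite morphim_injm_eq1 ?injm_sdpair1 //.
    by case/mingroupP: minLK => /andP[].
  have defW : W :=: L / K.
    apply: (mingroupP minLK).2; last exact: subsetIr.
    apply/andP; split.
      have := meet_center_nil (Fitting_nil X) nsVF ntV.
      apply: contraNneq => W1; rewrite -subG1.
      apply/subsetP=> _ /setIP[/morphimP[w _ Lw ->] Zw].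
      have : w \in W by apply/setIP; split=> //; apply/morphpreP.
      by rewrite W1 => /set1P->; rewrite morph1 set11.
    apply/subsetP=> _ /morphimP[g Ng Gg ->]; rewrite inE.
    apply/subsetP=> _ /imsetP[w /setIP[/morphpreP[_ Zw] Lw] ->].
    have Lwg : w ^ coset K g \in L / K.
      by rewrite memJ_norm // (subsetP (quotient_norms K nLG)) ?mem_quotient.
    apply/setIP; split=> //; apply/morphpreP; split=> //.
    rewrite -(chief_actsE LK Lw Gg) /= sdpair_act ?mem_quotient //.
    by rewrite memJ_norm // (subsetP (gFnorm_trans _ (gFnorm _ _))) ?inE.
  have sVZ : V \subset 'Z('F(X)).
    apply/subsetP=> _ /morphimP[w _ Lw ->].
    have : w \in W by rewrite defW.
    by case/setIP=> /morphpreP[].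
  have cVS : S \subset 'C(V).
    rewrite centsC (subset_trans sVZ) // (subset_trans (subsetIr _ _)) //.
    exact: centS.
  rewrite -quotient_cents2 ?(subset_trans sLG) ?(subset_trans sTG) //.
  rewrite centsC; apply/subsetP=> _ /morphimP[g _ Tg ->].
  have Gg := subsetP sTG g Tg.
  have Sg : sdpair2 to (coset C g) \in S.
    apply: (subsetP (residualS formF subF sDX)).
    by rewrite resD !mem_morphim ?(subsetP nCG) ?mem_quotient.
  apply/centP=> w Lw; apply/esym/commgP/conjg_fixP.
  rewrite -(chief_actsE LK Lw Gg); apply: (injmP (injm_sdpair1 to)) => //.
    rewrite (chief_actsE LK Lw Gg) memJ_norm //.
    by rewrite (subsetP (quotient_norms K nLG)) ?mem_quotient.
  rewrite /= sdpair_act ?mem_quotient //; apply/conjg_fixP/commgP.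
  rewrite centsC in cVS; apply: (centsP cVS) Sg.
  by apply: mem_morphim.
have sTC : residual F G \subset C.
  rewrite /C /= subsetI sTG astabQ -sub_morphim_pre ?(subset_trans sTG) //=.
  rewrite -quotientE centsC.
  by rewrite quotient_cents2 ?(subset_trans sTG) ?(subset_trans sLG).
apply: abelian_nil; apply: abelianS cVV; apply: (residual_min formF nsVX).
apply: (formation_homg formF) (residual_quotient_mem formF G).
have -> : (X / V = D / V)%G by apply/val_inj; rewrite /= -defX quotientMidl.
apply: homg_trans (quotient_homg nVD) _; apply: homg_trans (morphim_homg _ _) _.
  exact: subxx.
exact: homg_quotientS (normal_norm (residual_normal formF G)) nCG sTC.
Qed.

End CentralFactor.

Section Hypercenter.

Variables (pi : nat_pred) (pi_primes : {in pi, forall p, prime p}).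
Variable F : group_class.
Hypotheses (formF : formation F) (subF : subgroup_closed F).
Variables (gT : finGroupType) (G : {group gT}).
Hypothesis solG : solvable G.

Local Notation R := (residual_group F G).
Local Notation nF := (residual_product nilpotent_groups F).

(** From chief factors to series: peel off a top chief factor of [N] and induct on [#|N|]. From
    series to chief factors: the Jordan-Hoelder argument of [pi_hypercentral_chief]. *)
Lemma hypercentralP (N : {group gT}) :
  hypercentral G pi nF N <-> pi_hypercentral pi G R N.
Proof.
have sRG := residual_sub formF G.
split=> [[nsNG hypN] | hypN]; last first.
  split; first exact: pi_hypercentral_normal hypN.
  right=> K L LK sLN [p pi_p p_dv_LK]; apply/(central_factorP _ _ LK) => //.
  apply: pi_hypercentral_chief hypN sRG LK pi_p (pi_primes pi_p) p_dv_LK _.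
  exact: subset_trans (joing_subl N K).
case: hypN => [N1 | hypN].
  rewrite (_ : N = 1%G); first exact: pi_hypercentral1.
  exact/val_inj.
have [n] := ubnP #|N|; elim: n => // n IHn in N nsNG hypN *.
rewrite ltnS => leNn; have [-> | ntN] := eqVneq N 1%G.
  exact: pi_hypercentral1.
pose good (K : {group gT}) := (K \proper N) && (G \subset 'N(K)).
have prop1N : good 1%G.
  by rewrite /good proper1G ntN norms1.
have [K maxK _] := maxgroup_exists prop1N.
have NK : chief_factor G K N by apply/andP.
have /maxgroupP[/andP[ltKN nKG] _] := maxK; have sKN := proper_sub ltKN.
have nsKG : K <| G by rewrite /normal nKG (subset_trans sKN) ?normal_sub.
have hypK : pi_hypercentral pi G R K.
  apply: IHn nsKG _ _; last exact: leq_trans (proper_card ltKN) leNn.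
  by move=> K1 L1 LK1 sLK; apply: hypN; apply: subset_trans sKN.
apply: (pi_hypercentralS hypK sKN nsNG).
have nKN : N \subset 'N(K) by rewrite (subset_trans (normal_sub nsNG)).
have [pi'NK | ] := boolP (pi^'.-nat #|N : K|); first by left.
rewrite /pnat indexg_gt0 => /allPn[p]; rewrite mem_primes negbK.
case/and3P=> pr_p _ p_dv pi_p; right; apply/(central_factorP _ _ NK) => //.
by apply: hypN (subxx N) _; exists p; rewrite // card_quotient.
Qed.

Lemma hypercenter_hypercentral : pi_hypercentral pi G R (hypercenter G pi nF).
Proof.
have sRG := residual_sub formF G.
apply: (big_ind (pi_hypercentral pi G R)) => [|M N|N /asboolP/hypercentralP//].
  exact: pi_hypercentral1.
exact: pi_hypercentralY.
Qed.

Lemma sub_hypercenter (N : {group gT}) :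
  pi_hypercentral pi G R N -> N \subset hypercenter G pi nF.
Proof.
move=> hypN; rewrite /hypercenter bigprodGE sub_gen //.
by apply: bigcup_sup; apply/asboolP/hypercentralP.
Qed.

Lemma hyper_norm_hypercenter : hyper_norm pi F G = hypercenter G pi nF.
Proof.
apply/val_inj/eqP; rewrite eqEsubset /= sub_hypercenter /=.
  exact: hypercentral_sub_hyper_norm solG hypercenter_hypercentral.
exact: norm_series_hypercentral.
Qed.

Local Notation npF := (residual_product (pi_nilpotent_groups pi) F).

(** Let [T] be the residual of the join. It lies in the residual of [G], so [T :&: Z] has a series
    centralised by [T]; and [T / (T :&: Z)] is an image of the residual of [U]. The two series
    combine. *)
Lemma npF_join_hypercenter (U : {group gT}) :
  U \subset G -> npF U -> npF (U <*> hypercenter G pi nF)%G.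
Proof.
set Z := hypercenter G pi nF => sUG npU.
have hypZ : pi_hypercentral pi G R Z := hypercenter_hypercentral.
have nsZG := pi_hypercentral_normal hypZ; have [sZG nZG] := andP nsZG.
have nZU := subset_trans sUG nZG.
have sUZG : U <*> Z \subset G by rewrite join_subG sUG.
set T := residual_group F (U <*> Z)%G.
have sTUZ : T \subset U <*> Z := residual_sub formF _.
have sTG := subset_trans sTUZ sUZG.
have solT : solvable T := solvableS sTG solG.
apply: pi_nilpotent_pi_hypercentral solT _.
have nsTZ : T :&: Z <| T := normalGI sTG nsZG.
have hypTZ : pi_hypercentral pi T T (T :&: Z)%G.
  apply: (pi_hypercentral_sub hypZ); rewrite ?subsetIr //.
  exact: residualS.
apply: (pi_hypercentral_ext (subxx T) (normal_refl T) hypTZ).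
apply: pi_hypercentral_pi_nilpotent.
apply: pi_nilpotent_homg npU.
have nZT := subset_trans sTG nZG.
apply: (@homg_trans _ (T / Z)).
  by rewrite /= setIC; apply: isog_hom (second_isog nZT).
have -> : T / Z = residual F U / Z.
  rewrite -!residual_quotient ?(subset_trans sUZG) //.
  by congr (residual F _); apply/val_inj; rewrite /= quotientYidr.
by apply: quotient_homg; rewrite (subset_trans (residual_sub formF U)).
Qed.

Lemma hypercenter_sub_Int : hypercenter G pi nF \subset Int G npF.
Proof.
apply/bigcapsP=> U /asboolP[sUG npU maxU].
set Z := hypercenter G pi nF.
have sZG : Z \subset G.
  exact: normal_sub (pi_hypercentral_normal hypercenter_hypercentral).
have [sZU // | nsZU] := boolP (Z \subset U).
case: maxU; exists (U <*> Z)%G; split; last exact: npF_join_hypercenter.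
  by rewrite join_subG sUG.
rewrite properEneq joing_subl andbT; apply: contraNneq nsZU => ->.
exact: joing_subr.
Qed.

End Hypercenter.

(** * The boundary condition *)

Section IntHypercentral.

Variables (pi : nat_pred) (F : group_class).
Hypotheses (formF : formation F) (subF : subgroup_closed F).

Local Notation npF := (residual_product (pi_nilpotent_groups pi) F).

Lemma boundary_minnormal (gT : finGroupType) (G L : {group gT}) (p : nat) :
    boundary_condition_III pi F -> solvable G -> minnormal L G -> L \subset G ->
    p.-abelem L -> prime p -> p \in pi ->
    (forall U : {group gT}, U \subset G -> npF U -> npF (U <*> L)%G) ->
  p.-nat #|residual F G : 'C(L)|.
Proof.
move=> bndF solG minL sLG abL pr_p pi_p npL; have sRG := residual_sub formF G.
have [/andP[_ nLG] _] := mingroupP minL; have [pL cLL _] := and3P abL.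
pose C := ('C_G(L))%G; have nsCG : C <| G by rewrite norm_normalI ?norms_cent.
have [sCG nCG] := andP nsCG.
have resE : residual F (G / C) = residual F G / C by apply: residual_quotient.
have -> : #|residual F G : 'C(L)| = #|residual F (G / C)|.
  rewrite resE card_quotient ?(subset_trans sRG) // -[RHS]indexgI /= setIA.
  by rewrite (setIidPl sRG) indexgI.
apply: contraT => not_pR.
pose bad (B : {group coset_of C}) := ~~ p.-group (residual F B).
(* A minimal subgroup whose residual is not a p-group is critical, so the boundary condition makes
   its residual pi-nilpotent. *)
have [B /mingroupP[badB minB] sBG] := mingroup_exists (gP := bad) not_pR.
have critB : Crit (residual_product (p_groups p) F) B.
  split=> [pB | H ltHB]; first by rewrite /bad pB in badB.
  apply: contraT => badH; have eqHB := minB H badH (proper_sub ltHB).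
  by rewrite eqHB properxx in ltHB.
have npB := bndF p pi_p _ B critB (solvableS sBG (quotient_sol C solG)).
pose W := (coset C @*^-1 B)%G.
have sWG : W \subset G by rewrite -(quotientGK nsCG) morphpreS.
have sCW : C \subset W by rewrite -{1}[C : {set gT}]ker_coset morphpreS ?sub1G.
have nsCW : C <| W := normalS sCW sWG nsCG.
have defB : (W / C = B)%G by apply/val_inj; rewrite /= cosetpreK.
have [|V [sVW defW npV]] :=
  npF_supplement (pi := pi) formF (solvableS sWG solG) nsCW.
  by rewrite defB.
have sVG := subset_trans sVW sWG; set VL := (V <*> L)%G.
have sVLG : VL \subset G by rewrite join_subG sVG.
set S := residual_group F VL; have nsSVL : S <| VL := residual_normal formF VL.
have sSG := subset_trans (normal_sub nsSVL) sVLG.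
have npS : pi_nilpotent_groups pi S := npL V sVG npV.
have pS := (pi_nilpotentP pi S).1 npS p pr_p pi_p.
(* [L] and the p'-core of [S] normalise each other and have coprime orders. Hence the image of [S]
   modulo [C], which is the residual of [B], is a p-group. *)
have sOC : 'O_p^'(S) \subset C.
  rewrite subsetI (subset_trans (pcore_sub _ _)) //= (sameP commG1P trivgP).
  have <- : L :&: 'O_p^'(S) = 1.
    by apply: coprime_TIg; apply: pnat_coprime pL (pcore_pgroup _ _).
  rewrite subsetI.
  have nLS : S \subset 'N(L) := subset_trans sSG nLG.
  have nOL : L \subset 'N('O_p^'(S)).
    have nSL := subset_trans (joing_subr V L) (normal_norm nsSVL).
    by rewrite (gFnorm_trans _ nSL).
  by rewrite commg_subl commg_subr nOL (subset_trans (pcore_sub _ _)).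
have resB : residual F B = S / C.
  have nCVL := subset_trans sVLG nCG.
  rewrite -(residual_quotient formF nCVL) -defB; congr (residual F _).
  apply/val_inj; rewrite /= quotientY ?(subset_trans _ nCG) //.
  have /quotientS1 -> : L \subset C by rewrite subsetI sLG.
  by rewrite joingG1 -defW quotientMidl.
case/negP: badB; rewrite /bad resB /pgroup card_quotient ?(subset_trans sSG) //.
apply: pnat_dvd (indexgS S sOC) _.
by rewrite -card_quotient ?gFnorm.
Qed.

(** Stability of the class under joins with [N] replaces containment in [Int] because it is
    inherited by [G / L]: by [npF_supplement] a subgroup of [G / L] in the class is the image of a
    subgroup of [G] in the class. *)
Lemma boundary_join_hypercentral (gT : finGroupType) (G N : {group gT}) :
    boundary_condition_III pi F -> solvable G -> N <| G ->
    (forall U : {group gT}, U \subset G -> npF U -> npF (U <*> N)%G) ->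
  pi_hypercentral pi G (residual_group F G) N.
Proof.
move=> bndF; have [n] := ubnP #|G|; elim: n => // n IHn in gT G N *.
rewrite ltnS => leGn solG nsNG npN; have [sNG nNG] := andP nsNG.
have sRG := residual_sub formF G.
have [-> | ntN] := eqVneq N 1%G; first exact: pi_hypercentral1.
have [L minL sLN] := minnormal_exists ntN nNG.
have sLG := subset_trans sLN sNG.
have [_ ntL /is_abelemP[p pr_p abL]] := minnormal_solvable minL sLG solG.
have nsLG : L <| G by case/mingroupP: minL => /andP[_ nLG] _; apply/andP.
have nLG := normal_norm nsLG.
have hypL : pi_hypercentral pi G (residual_group F G) L.
  apply: (minnormal_pi_hypercentral minL sLG (abelem_pgroup abL) pr_p).
    exact: residual_normal.
  move=> pi_p; apply: boundary_minnormal => // U sUG npU.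
  have sUNG : U <*> N \subset G by rewrite join_subG sUG.
  apply: npFS (npN U sUG npU) => //; first exact: solvableS solG.
  by rewrite genS ?setUS.
apply: (pi_hypercentral_ext sRG nsNG hypL).
have -> : (residual_group F G / L = residual_group F (G / L))%G.
  by apply/val_inj; rewrite /= residual_quotient.
apply: IHn; rewrite ?quotient_sol ?quotient_normal //.
  by apply: leq_trans leGn; rewrite ltn_quotient.
move=> U sUG npU; pose W := (coset L @*^-1 U)%G.
have sWG : W \subset G by rewrite -(quotientGK nsLG) morphpreS.
have sLW : L \subset W by rewrite -{1}[L : {set gT}]ker_coset morphpreS ?sub1G.
have defU : (W / L = U)%G by apply/val_inj; rewrite /= cosetpreK.
have npWL : npF (W / L)%G by rewrite defU.
have [V [sVW defW npV]] :=
  npF_supplement formF (solvableS sWG solG) (normalS sLW sWG nsLG) npWL.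
have sVG := subset_trans sVW sWG.
have sVNG : V <*> N \subset G by rewrite join_subG sVG.
have -> : (U <*> (N / L) = (V <*> N) / L)%G.
  apply/val_inj; rewrite /= quotientY ?(subset_trans _ nLG) //.
  by rewrite -[in RHS](quotientMidl L V) defW -defU.
apply: (npF_homg formF) (npN V sVG npV).
by apply: quotient_homg; apply: subset_trans nLG.
Qed.

Lemma class_maximal_exists (gT : finGroupType) (G U : {group gT}) :
  U \subset G -> npF U -> exists2 W, class_maximal G npF W & U \subset W.
Proof.
move=> sUG npU; pose good (V : {group gT}) := (V \subset G) && `[< npF V >].
have goodU : good U by rewrite /good sUG; apply/asboolP.
have [W /maxgroupP[/andP[sWG /asboolP npW] maxW] sUW] := maxgroup_exists goodU.
exists W => //; split=> // -[V [sVG ltWV npV]].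
have := maxW V; rewrite /good sVG asboolT // => /(_ isT (proper_sub ltWV)) eqVW.
by rewrite eqVW properxx in ltWV.
Qed.

Lemma class_maximalJ (gT : finGroupType) (G U : {group gT}) x :
  x \in G -> class_maximal G npF U -> class_maximal G npF (U :^ x)%G.
Proof.
move=> Gx [sUG npU maxU]; have npJ (V : {group gT}) y : npF V -> npF (V :^ y)%G.
  by apply: npF_homg => //; apply: isog_hom; rewrite isog_sym conj_isog.
split; [by rewrite conj_subG | exact: npJ |].
case=> V [sVG ltUV npV]; case: maxU; exists (V :^ x^-1)%G.
split; [by rewrite conj_subG ?groupV| |exact: npJ].
by rewrite -(properJ _ _ x) conjsgKV.
Qed.

Lemma Int_sub_hypercenter (gT : finGroupType) (G : {group gT}) :
    {in pi, forall p, prime p} -> boundary_condition_III pi F -> solvable G ->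
  Int G npF \subset hypercenter G pi (residual_product nilpotent_groups F).
Proof.
move=> pi_primes bndF solG.
pose N := [group of \bigcap_(U : {group gT} | `[< class_maximal G npF U >]) U].
suff: N \subset hypercenter G pi (residual_product nilpotent_groups F) by [].
have max_sub (U : {group gT}) : U \subset G -> npF U ->
  exists2 W : {group gT}, U <*> N \subset W & W \subset G /\ npF W.
- move=> sUG npU; have [W maxW sUW] := class_maximal_exists sUG npU.
  exists W; last by case: maxW.
  by rewrite join_subG sUW bigcap_inf //; apply/asboolP.
(* This guarantees a maximal subgroup: an intersection over an empty family would be the whole type
   rather than a subgroup of [G]. *)
have np1 : npF [1 gT]%G.
  rewrite /residual_product /pi_nilpotent_groups.
  have -> : residual_group F [1 gT]%G = 1%G.
    by apply/val_inj/trivgP/residual_sub.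
  by apply: quotient_nil; apply: nilpotent1.
apply: sub_hypercenter => //; apply: boundary_join_hypercentral => //.
  apply/andP; split.
    have [W sW [sWG _]] := max_sub 1%G (sub1G G) np1.
    by apply: subset_trans sWG; rewrite joing1G in sW.
  apply/subsetP=> x Gx; rewrite inE; apply/bigcapsP=> U /asboolP maxU.
  rewrite sub_conjg; apply: (bigcap_inf (U :^ x^-1)%G) => //.
  by apply/asboolP/class_maximalJ; rewrite ?groupV.
move=> U sUG npU; have [W sUNW [sWG npW]] := max_sub U sUG npU.
exact: npFS (solvableS sWG solG) sUNW npW.
Qed.

End IntHypercentral.

(* The regular wreath product, with base the group ring of G over 'F_p. *)
Lemma faithful_abelem_extension (gT : finGroupType) (G : {group gT}) (p : nat) :
    prime p ->
  exists (xT : finGroupType) (X V D : {group xT}),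
    [/\ V ><| D = X, p.-abelem V, D \isog G & 'C_D(V) = 1].
Proof.
move=> pr_p; pose rG := regular_repr 'F_p G.
pose to := ('MR rG)%gact.
exists (sdprod_by to), [set: sdprod_by to]%G.
exists (sdpair1 to @* setT)%G, (sdpair2 to @* G)%G; split.
- exact: sdprod_sdpair.
- by rewrite morphim_abelem // mx_Fp_abelem.
- by rewrite isog_sym sub_isog ?injm_sdpair2.
apply/trivgP/subsetP=> _ /setIP[/morphimP[a _ Ga ->] cVa].
suff -> : a = 1 by rewrite morph1 set11.
(* An element centralising the base fixes every standard basis vector, so its matrix is the
   identity; the regular representation is faithful. *)
apply: (mx_faithful_inj (regular_mx_faithful 'F_p G)); rewrite // repr_mx1.
apply/row_matrixP=> i; rewrite !rowE mulmx1 -mx_repr_actE //.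
set u := delta_mx _ _.
apply: (injmP (injm_sdpair1 to)); rewrite ?inE //=.
rewrite (sdpair_act to) ?inE //; apply/conjg_fixP/commgP/esym.
by apply: (centP cVa); rewrite mem_morphim ?inE.
Qed.

Section Boundary.

Variables (pi : nat_pred) (pi_primes : {in pi, forall p, prime p}).
Variable F : group_class.
Hypotheses (formF : formation F) (subF : subgroup_closed F).

Local Notation npF := (residual_product (pi_nilpotent_groups pi) F).
Local Notation nF := (residual_product nilpotent_groups F).

Lemma residual_pgroup_homg (aT rT : finGroupType) (p : nat) (G : {group aT})
    (H : {group rT}) :
  H \homg G -> p.-group (residual F G) -> p.-group (residual F H).
Proof.
case/homgP=> f defH pG; have <- : (f @* G)%G = H by apply/val_inj.
by rewrite /= residual_morphim // morphim_pgroup.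
Qed.

Lemma boundary_of_Int :
    (forall (gT : finGroupType) (G : {group gT}), solvable G ->
       hypercenter G pi nF = Int G npF :> {set gT}) ->
  boundary_condition_III pi F.
Proof.
move=> IntE p pi_p gT G [not_pG critG] solG; have pr_p := pi_primes pi_p.
apply: contrapT => not_npG; case: not_pG.
have [xT [X [V [D [defX abV isoDG CDV1]]]]] :=
  faithful_abelem_extension G pr_p.
have [nsVX sDX _ nVD _] := sdprod_context defX; have [sVX nVX] := andP nsVX.
have isoX := sdprod_isog defX; have pV := abelem_pgroup abV.
have solX : solvable X.
  rewrite (series_sol nsVX) (pgroup_sol pV) -(isog_sol isoX).
  by rewrite (isog_sol isoDG).
have isoXG : X / V \isog G by apply: isog_trans isoDG; rewrite isog_sym.
have [f injf imf] := isogP isoXG.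
(* As [G] is outside the class, [U] cannot cover [X / V]. So [U / V] is isomorphic to a proper
   subgroup of [G] and has a p-group as residual; so does [V <*> U], since [V] is a p-group. *)
have npUV (U : {group xT}) : U \subset X -> npF U -> npF (V <*> U)%G.
  move=> sUX npU; have nVU := subset_trans sUX nVX.
  have ltUX : U / V \proper X / V.
    rewrite properEneq quotientS // andbT; apply/eqP=> eqUX; case: not_npG.
    apply: (npF_homg formF) npU; apply: homg_trans (quotient_homg nVU).
    by rewrite eqUX; apply: isog_hom; rewrite isog_sym.
  have ltfUG : f @* (U / V) \proper G.
    rewrite properEcard -imf morphimS ?quotientS //=.
    by rewrite !(card_injm injf) ?quotientS // proper_card.
  have pU : p.-group (residual F U / V).
    rewrite -residual_quotient //.
    apply: residual_pgroup_homg (critG (f @* (U / V))%G ltfUG).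
    by apply: isog_hom; rewrite sub_isog ?quotientS.
  have sVUX : V <*> U \subset X by rewrite join_subG sVX.
  have nVVU := subset_trans sVUX nVX.
  have pVU : p.-group (residual F (V <*> U)).
    rewrite -(pquotient_pgroup pV) ?(subset_trans (residual_sub formF _)) //.
    rewrite -residual_quotient //.
    have -> : (V <*> U / V = U / V)%G by apply/val_inj; apply: quotientYidl.
    by rewrite residual_quotient.
  by apply: quotient_nil; apply: pgroup_nil pVU.
have sVInt : V \subset Int X npF.
  apply/bigcapsP=> U /asboolP[sUX npU maxU].
  have [// | nsVU] := boolP (V \subset U); case: maxU; exists (V <*> U)%G.
  split; [by rewrite join_subG sVX | | exact: npUV].
  rewrite properEneq joing_subr andbT; apply: contraNneq nsVU => ->.
  exact: joing_subl.
rewrite -IntE // in sVInt.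
have hypV : pi_hypercentral pi X (residual_group F X) V.
  have hypZ := hypercenter_hypercentral pi_primes formF subF solX.
  apply: (pi_hypercentral_sub hypZ) => //.
  exact: residual_sub.
have sRD := residual_sub formF D.
(* A Hall p'-subgroup of the residual of [D] centralises the hypercentral p-group [V]; since [D]
   acts faithfully on [V], this residual is a p-group, contrary to the choice of [G]. *)
have solR : solvable (residual F D) := solvableS (subset_trans sRD sDX) solX.
have [Q hallQ] := Hall_exists p^' solR; have [sQR p'Q _] := and3P hallQ.
have cVQ : Q \subset 'C(V).
  apply: (pi_hypercentral_p'subgroup hypV pV pi_p) p'Q.
    exact: subset_trans sQR (residualS formF subF sDX).
  exact: residual_sub.
have := Hall_cent_index hallQ cVQ; rewrite -indexgI.
have -> : residual F D :&: 'C(V) = 1.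
  by apply/trivgP; rewrite -CDV1 setSI.
rewrite indexg1 => pD; apply: residual_pgroup_homg pD.
by apply: isog_hom; rewrite isog_sym.
Qed.

End Boundary.

Theorem theoremE (pi : nat_pred) (pi_primes : {in pi, forall p, prime p})
    (F : group_class) (formationF : formation F) (subF : subgroup_closed F) :
  [<-> forall (gT : finGroupType) (G : {group gT}), solvable G ->
         hyper_norm pi F G
           = Int G (residual_product (pi_nilpotent_groups pi) F) :> {set gT};
       forall (gT : finGroupType) (G : {group gT}), solvable G ->
         hypercenter G pi (residual_product nilpotent_groups F)
           = Int G (residual_product (pi_nilpotent_groups pi) F) :> {set gT};
       boundary_condition_III pi F].
Proof.
tfae=> [IntE gT G solG | | bndF gT G solG].
- by rewrite -IntE // (hyper_norm_hypercenter pi_primes).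
- exact: boundary_of_Int.
rewrite (hyper_norm_hypercenter pi_primes) //; apply/eqP.
by rewrite eqEsubset hypercenter_sub_Int // Int_sub_hypercenter.
Qed.
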